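(* Let $n\ge 2$ and $0\le\alpha<n$. Then there is a sequence $\{(\widehat\sigma_N,\widehat\omega_N)\}_{N=1}^\infty$ of pairs of locally finite positive Borel measures on $\mathbb{R}^n$, each of which is a finite sum of point masses, such that the backward deep energy constants $\mathcal{E}_2^{\alpha,\operatorname{deep},\ast}(\widehat\sigma_N,\widehat\omega_N)$ are unbounded in $N\ge1$, and yet the vector fractional Riesz transform $\mathbf{R}^{\alpha,n}$ is bounded from $L^2(\widehat\sigma_N)$ to $L^2(\widehat\omega_N)$ uniformly in $N\ge1$, i.e. there is a constant $C<\infty$ independent of $N$ with $\|\mathbf{R}^{\alpha,n}_{\widehat\sigma_N,\delta,R}f\|_{L^2(\widehat\omega_N)}\le C\|f\|_{L^2(\widehat\sigma_N)}$ for all $N\ge1$, all $f\in L^2(\widehat\sigma_N)$ and all $0<\delta<R<\infty$.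
   Context: The vector fractional Riesz transform $\mathbf{R}^{\alpha,n}$ on $\mathbb{R}^n$ is the convolution operator with vector kernel $\mathbf{K}^{\alpha,n}(x,y)=\frac{x-y}{|x-y|^{n+1-\alpha}}$. Its truncations are $\mathbf{R}^{\alpha,n}_{\sigma,\delta,R}f(x)=\int\eta_{\delta,R}(|x-y|)\mathbf{K}^{\alpha,n}(x,y)f(y)\,d\sigma(y)$, where $\{\eta_{\delta,R}\}_{0<\delta<R<\infty}$ is a fixed family of nonnegative functions on $[0,\infty)$ making the truncated kernels bounded with compact support for fixed $x$ or $y$ (in the presence of the Muckenhoupt conditions the choice of truncation family does not matter); boundedness from $L^2(\sigma)$ to $L^2(\omega)$ means these truncations are bounded uniformly in $0<\delta<R$. Notation: cubes are axis-parallel; $\ell(Q)$ is the side length, $|Q|$ the Lebesgue measure, $c_Q$ the center, $|Q|_\mu=\mu(Q)$. The standard Poisson integral is $\mathrm{P}^\alpha(Q,\mu)=\int_{\mathbb{R}^n}\frac{|Q|^{1/n}}{(|Q|^{1/n}+|x-c_Q|)^{n+1-\alpha}}d\mu(x)$. For a cube $M$ and measure $\mu$, $\mathsf{P}^\mu_M$ denotes the orthogonal projection of $L^2(\mu)$ onto the subspace of functions supported in $M$ with $\int_M f\,d\mu=0$ (the Haar projection $\sum_{J\in\mathcal D,J\subset M}\triangle^\mu_J$), applied componentwise to the identity function $x$. Deep embedding: fix parameters $\mathbf r\in\mathbb{N}$, $0<\varepsilon<1$, $\gamma>1$. A dyadic cube $J$ is $(\mathbf r,\varepsilon)$-deeply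 embedded in a cube $K$, written $J\Subset_{\mathbf r,\varepsilon}K$, if $J\subset K$, $\ell(J)\le 2^{-\mathbf r}\ell(K)$ and $\operatorname{dist}(J,\partial K)\ge\frac12\ell(J)^\varepsilon\ell(K)^{1-\varepsilon}$. For a dyadic grid $\mathcal D$ and cube $K$, $\mathcal M_{\operatorname{deep}}(K)$ is the set of maximal $\mathcal D$-dyadic $J\Subset_{\mathbf r,\varepsilon}K$, and for $\ell\ge1$, $\mathcal M^\ell_{\operatorname{deep}}(K)$ is the set of $J\in\mathcal M_{\operatorname{deep}}(\pi^\ell K')$ for some $\mathcal D$-dyadic child $K'$ of $K$ ($\pi^\ell K'$ its $\ell$-th dyadic ancestor) such that $J\subset L$ for some $L\in\mathcal M_{\operatorname{deep}}(K)$. The backward deep energy constant of a pair $(\sigma,\omega)$ is given by $$\big(\mathcal{E}_2^{\alpha,\operatorname{deep},\ast}\big)^2=\sup_{\ell\ge1}\sup_{\mathcal D}\sup_{I=\dot\cup I_r}\frac{1}{|I|_\omega}\sum_{r}\sum_{M\in\mathcal M^\ell_{\operatorname{deep}}(I_r)}\Big(\frac{\mathrm{P}^\alpha(M,\mathbf 1_{I\setminus\gamma M}\omega)}{\ell(M)}\Big)^2\|\mathsf P^\sigma_M x\|^2_{L^2(\sigma)},$$ the suprema over all dyadic grids $\mathcal D$, all $\mathcal D$-dyadic cubes $I$, and all partitions of $I$ into $\mathcal D$-dyadic subcubes $I_r$ (i.e. the forward deep energy with the roles of $\sigma$ and $\omega$ interchanged). *)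

(* Defs.v *)
From HB Require Import structures.
From mathcomp Require Import all_boot all_order all_algebra.
From mathcomp Require Import all_classical all_reals all_analysis.
Set Implicit Arguments. Unset Strict Implicit. Unset Printing Implicit Defensive.
Import Order.TTheory GRing.Theory Num.Theory.
Import numFieldNormedType.Exports.
Local Open Scope classical_set_scope.
Local Open Scope ring_scope.

Section Defs.
Variables (R : realType) (n : nat).

Definition pt := 'rV[R]_n.

Definition enorm (x : pt) : R := Num.sqrt (\sum_(i < n) (x ord0 i) ^+ 2).

(* A positive measure which is a finite sum of point masses:
   the list of pairs (point, mass); the measure is \sum_k m_k \delta_{p_k}. *)
Definition dmeas := seq (pt * R).
Definition pos_dmeas (mu : dmeas) : Prop := forall pw, pw \in mu -> 0 < pw.2.

Definition dmass (mu : dmeas) (A : set pt) : R :=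
  \sum_(pw <- mu) (if `[< A pw.1 >] then pw.2 else 0).
Definition dint (mu : dmeas) (A : set pt) (f : pt -> R) : R :=
  \sum_(pw <- mu) (if `[< A pw.1 >] then f pw.1 * pw.2 else 0).

Definition cube := (pt * R)%type.
Definition cube_set (Q : cube) : set pt :=
  [set x | forall i : 'I_n, Q.1 ord0 i <= x ord0 i < Q.1 ord0 i + Q.2].
Definition side (Q : cube) : R := Q.2.
Definition center (Q : cube) : pt := Q.1 + (Q.2 / 2) *: const_mx 1.
Definition dilate (c : R) (Q : cube) : cube :=
  (center Q - (c * Q.2 / 2) *: const_mx 1, c * Q.2).

(* dyadic grids: at each level k : int the cubes of side 2^k form the
   lattice 2^k Z^n + t k, and the levels are nested. *)
Definition grid_ok (t : int -> pt) : Prop :=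
  forall (k : int) (i : 'I_n), exists z : int,
    t k ord0 i - t (k + 1)%R ord0 i = (2 : R) ^ k * z%:~R.
Definition in_grid (t : int -> pt) (Q : cube) : Prop :=
  exists (k : int) (m : 'I_n -> int),
    Q.2 = (2 : R) ^ k /\ forall i, Q.1 ord0 i = (2 : R) ^ k * (m i)%:~R + t k ord0 i.

Definition dist_set (A B : set pt) : R :=
  inf [set enorm (x - y) | x in A & y in B].
Definition bdry (A : set pt) : set pt := closure A `\` interior A.

Definition deep_emb (r : nat) (eps : R) (J K : cube) : Prop :=
  cube_set J `<=` cube_set K /\
  side J <= (2 : R) ^- r * side K /\
  dist_set (cube_set J) (bdry (cube_set K)) >=
    2^-1 * (powR (side J) eps) * (powR (side K) (1 - eps)).

Definition Mdeep (t : int -> pt) (r : nat) (eps : R) (K : cube) : set cube :=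
  [set J | in_grid t J /\ deep_emb r eps J K /\
     forall J', in_grid t J' -> deep_emb r eps J' K ->
       cube_set J `<=` cube_set J' -> cube_set J' = cube_set J].

Definition dchild (t : int -> pt) (K' K : cube) : Prop :=
  in_grid t K' /\ side K' = side K / 2 /\ cube_set K' `<=` cube_set K.
Definition dancestor (t : int -> pt) (l : nat) (K' P : cube) : Prop :=
  in_grid t P /\ side P = (2 : R) ^+ l * side K' /\ cube_set K' `<=` cube_set P.

Definition Mdeep_l (t : int -> pt) (r : nat) (eps : R) (l : nat) (K : cube)
  : set cube :=
  [set J | (exists K' P, dchild t K' K /\ dancestor t l K' P /\ Mdeep t r eps P J)
           /\ exists L, Mdeep t r eps K L /\ cube_set J `<=` cube_set L].

Definition poisson (alpha : R) (Q : cube) (mu : dmeas) (A : set pt) : R :=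
  dint mu A (fun x => side Q /
     powR (side Q + enorm (x - center Q)) (n%:R + 1 - alpha)).

(* || P^mu_M x ||^2_{L^2(mu)}, where P^mu_M is the orthogonal projection
   onto the functions supported in M with mu-integral 0, i.e.
   P^mu_M f = 1_M (f - <f>^mu_M)  (and 0 if mu(M) = 0), applied componentwise
   to the identity function x. *)
Definition proj_x_sq (mu : dmeas) (M : cube) : R :=
  let avg := (dmass mu (cube_set M))^-1 *:
             \sum_(pw <- mu) (if `[< cube_set M pw.1 >] then pw.2 *: pw.1 else 0) in
  dint mu (cube_set M) (fun x => enorm (x - avg) ^+ 2).

Definition bw_deep_energy_sq (alpha : R) (r : nat) (eps gam : R)
  (sigma omega : dmeas) : \bar R :=
  ereal_sup [set x | exists (l : nat) (t : int -> pt) (I : cube) (Pt : set cube),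
    (1 <= l)%N /\ grid_ok t /\ in_grid t I /\
    (forall Q, Pt Q -> in_grid t Q /\ cube_set Q `<=` cube_set I) /\
    (forall Q Q', Pt Q -> Pt Q' -> Q <> Q' -> cube_set Q `&` cube_set Q' = set0) /\
    cube_set I = \bigcup_(Q in Pt) cube_set Q /\
        x = (((dmass omega (cube_set I))^-1)%:E *
            \esum_(Ir in Pt) \esum_(M in Mdeep_l t r eps l Ir)
               ((poisson alpha M omega (cube_set I `\` cube_set (dilate gam M))
                   / side M) ^+ 2 * proj_x_sq sigma M)%:E)%E].

Definition eta (delta R0 s : R) : R := if (delta <= s <= R0) then 1 else 0.

Definition riesz_trunc (alpha : R) (sigma : dmeas) (delta R0 : R) (f : pt -> R)
  (x : pt) : pt :=
  \sum_(pw <- sigma)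
     (eta delta R0 (enorm (x - pw.1)) * f pw.1 * pw.2 /
        powR (enorm (x - pw.1)) (n%:R + 1 - alpha)) *: (x - pw.1).

Definition L2norm (mu : dmeas) (f : pt -> R) : R :=
  Num.sqrt (dint mu setT (fun x => f x ^+ 2)).
Definition L2norm_vec (mu : dmeas) (F : pt -> pt) : R :=
  Num.sqrt (dint mu setT (fun x => enorm (F x) ^+ 2)).

End Defs.

(* Main.v *)
Require Import Defs.
From HB Require Import structures.
From mathcomp Require Import all_boot all_order all_algebra.
From mathcomp Require Import all_classical all_reals all_analysis.
From mathcomp Require Import ring lra.
Import Order.TTheory GRing.Theory Num.Theory.
Import numFieldNormedType.Exports.
Local Open Scope classical_set_scope.
Local Open Scope ring_scope.

(** Write s = n - alpha. Four unit masses at (±1, ±b) produce a Riesz field which vanishes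
    at both points (±d, 0) for a suitable b: there the second component cancels by symmetry
    and the first one because u / (u^2 + b^2)^((s+1)/2) takes the same value at 1 + d and at
    1 - d. Iterating this configuration N times with a tiny ratio tau gives a probability
    measure omega carried by 4^N points, and each node of the tree, of scale rho = tau^k and
    mass u = 4^-k, carries two points of sigma, of mass rho^(2s) / u, at the zeros of the
    field of its four children.

    Because of the exact cancellation, the adjoint operator applied to g sees, at the
    sigma-points of a node, only the martingale difference of g at that node; by the law of
    total variance the squares of these differences add up to at most |g|^2, so the norm
    stays bounded, up to interactions between different scales, which vanish as tau -> 0,
    and up to the at most two scales cut by the truncation. On the other hand no omega-mass
    lies near the two sigma-points of a node, so that the node contributes a constant times
    u to the energy, and each of the N generations a constant. *)

Set Implicit Arguments. Unset Strict Implicit. Unset Printing Implicit Defensive.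

(** * Weighted sums *)

Section SquareInequalities.
Context {R : realFieldType}.
Implicit Types (x y c : R).

Lemma sqr_le_norm x c : `|x| <= c -> x ^+ 2 <= c ^+ 2.
Proof.
move=> xc; rewrite -real_normK ?num_real// lerXn2r ?nnegrE//.
exact: le_trans xc.
Qed.

Lemma sqrD_le x y c : 0 < c ->
  (x + y) ^+ 2 <= (1 + c) * x ^+ 2 + (1 + c^-1) * y ^+ 2.
Proof.
move=> c0; rewrite -subr_ge0.
have -> : (1 + c) * x ^+ 2 + (1 + c^-1) * y ^+ 2 - (x + y) ^+ 2 =
  c^-1 * (c * x - y) ^+ 2 by field; exact: lt0r_neq0.
by rewrite mulr_ge0 ?sqr_ge0 ?invr_ge0 ?ltW.
Qed.

Lemma mulr_le_sqrD x y c : 0 < c ->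
  x * y <= 2^-1 * (c * x ^+ 2 + c^-1 * y ^+ 2).
Proof.
move=> c0; rewrite -subr_ge0.
have -> : 2^-1 * (c * x ^+ 2 + c^-1 * y ^+ 2) - x * y =
  2^-1 * (c^-1 * (c * x - y) ^+ 2) by field; exact: lt0r_neq0.
by rewrite mulr_ge0 ?invr_ge0// mulr_ge0 ?sqr_ge0 ?invr_ge0 ?ltW.
Qed.

End SquareInequalities.

Section WeightedSums.
Context {R : realFieldType} {T : eqType}.
Implicit Types (mu : seq (T * R)) (F G : T -> R) (c : R).

Definition wsum mu F : R := \sum_(q <- mu) q.2 * F q.1.

Definition pos_weights mu : Prop := forall q, q \in mu -> 0 < q.2.

Definition prob_weights mu : Prop := pos_weights mu /\ wsum mu (cst 1) = 1.

Definition wvar mu F : R := wsum mu (fun x => F x ^+ 2) - wsum mu F ^+ 2.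

Lemma eq_wsum mu F G : (forall q, q \in mu -> F q.1 = G q.1) ->
  wsum mu F = wsum mu G.
Proof. by move=> FG; apply: eq_big_seq => q /FG ->. Qed.

Lemma wsumD mu F G : wsum mu (fun x => F x + G x) = wsum mu F + wsum mu G.
Proof. by rewrite /wsum -big_split; apply: eq_bigr => q _; rewrite mulrDr. Qed.

Lemma wsumZ mu c F : wsum mu (fun x => c * F x) = c * wsum mu F.
Proof. by rewrite /wsum mulr_sumr; apply: eq_bigr => q _; rewrite mulrCA. Qed.

Lemma wsumB mu F G : wsum mu (fun x => F x - G x) = wsum mu F - wsum mu G.
Proof.
by rewrite -[X in _ = _ + X]mulN1r -wsumZ -wsumD; apply: eq_wsum => q _; rewrite mulN1r.
Qed.

Lemma wsum_cst mu c : wsum mu (cst c) = c * wsum mu (cst 1).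
Proof. by rewrite -wsumZ; apply: eq_wsum => q _ /=; rewrite mulr1. Qed.

Lemma wsum_sum (J : finType) mu (F : J -> T -> R) :
  wsum mu (fun x => \sum_j F j x) = \sum_j wsum mu (F j).
Proof. by rewrite /wsum exchange_big; apply: eq_bigr => q _ /=; rewrite mulr_sumr. Qed.

Lemma wsum_cat mu nu F : wsum (mu ++ nu) F = wsum mu F + wsum nu F.
Proof. exact: big_cat. Qed.

Lemma le_wsum mu F G : pos_weights mu ->
  (forall q, q \in mu -> F q.1 <= G q.1) -> wsum mu F <= wsum mu G.
Proof.
move=> mu0 FG; rewrite /wsum !big_seq; apply: ler_sum => q qmu.
by rewrite ler_wpM2l ?FG// ltW// mu0.
Qed.

Lemma wsum_ge0 mu F : pos_weights mu ->
  (forall q, q \in mu -> 0 <= F q.1) -> 0 <= wsum mu F.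
Proof.
move=> mu0 F0; rewrite /wsum big_seq; apply: sumr_ge0 => q qmu.
by rewrite mulr_ge0 ?F0// ltW// mu0.
Qed.

Lemma wvarE mu F : prob_weights mu ->
  wvar mu F = wsum mu (fun x => (F x - wsum mu F) ^+ 2).
Proof.
case=> _ mu1; rewrite /wvar; set m := wsum mu F.
rewrite -[RHS](@eq_wsum _ (fun x => F x ^+ 2 + (- 2 * m * F x + m ^+ 2 * cst 1 x))).
  by rewrite !wsumD !wsumZ mu1 -/m; ring.
by move=> q _ /=; ring.
Qed.

Lemma wvar_ge0 mu F : prob_weights mu -> 0 <= wvar mu F.
Proof.
by move=> mup; rewrite wvarE//; apply: wsum_ge0 (mup.1) _ => q _; exact: sqr_ge0.
Qed.

Lemma sqr_wsum_le mu F : prob_weights mu ->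
  wsum mu F ^+ 2 <= wsum mu (fun x => F x ^+ 2).
Proof. by rewrite -subr_ge0; exact: wvar_ge0. Qed.

Lemma sqr_wsum_mul_le mu F G c : prob_weights mu ->
  (forall q, q \in mu -> `|F q.1| <= c) ->
  wsum mu (fun x => F x * G x) ^+ 2 <= c ^+ 2 * wsum mu (fun x => G x ^+ 2).
Proof.
move=> mup Fc; apply: le_trans (sqr_wsum_le _ mup) _; rewrite -wsumZ.
apply: le_wsum (mup.1) _ => q qmu.
by rewrite exprMn ler_wpM2r ?sqr_ge0// sqr_le_norm// Fc.
Qed.

(* A centered weight only sees the deviation of [G] from its mean. *)
Lemma sqr_wsum_centered_mul_le mu F G c : prob_weights mu -> wsum mu F = 0 ->
  (forall q, q \in mu -> `|F q.1| <= c) ->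
  wsum mu (fun x => F x * G x) ^+ 2 <= c ^+ 2 * wvar mu G.
Proof.
move=> mup F0 Fc; set m := wsum mu G.
have -> : wsum mu (fun x => F x * G x) = wsum mu (fun x => F x * (G x - m)).
  rewrite -[LHS]subr0 -(mulr0 m) -F0 -wsumZ -wsumB.
  by apply: eq_wsum => q _; ring.
by rewrite wvarE//; exact: sqr_wsum_mul_le.
Qed.

End WeightedSums.

(* With [h := T f] one has [|h|^2 = <f, T^* h> <= (c |f|^2 + |T^* h|^2 / c) / 2]. *)
Lemma wsum_kernel_adjoint_le (R : realFieldType) (S T : eqType)
    (sigma : seq (S * R)) (omega : seq (T * R)) (k : T -> S -> R) (c : R) :
  0 < c -> pos_weights sigma ->
  (forall g, wsum sigma (fun y => wsum omega (fun x => k x y * g x) ^+ 2)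
     <= c * wsum omega (fun x => g x ^+ 2)) ->
  forall f, wsum omega (fun x => wsum sigma (fun y => k x y * f y) ^+ 2)
     <= c * wsum sigma (fun y => f y ^+ 2).
Proof.
move=> c0 sigma0 adjoint_le f; set h := fun x => wsum sigma (fun y => k x y * f y).
pose Th y := wsum omega (fun x => k x y * h x).
have pairing : wsum omega (fun x => h x ^+ 2) = wsum sigma (fun y => f y * Th y).
  rewrite {1}/wsum.
  under eq_bigr => q _ do rewrite expr2 {1}/h /wsum mulr_suml mulr_sumr.
  rewrite exchange_big /=; apply: eq_bigr => q _.
  by rewrite /Th /wsum !mulr_sumr; apply: eq_bigr => x _; ring.
have : wsum omega (fun x => h x ^+ 2) <=
    2^-1 * (c * wsum sigma (fun y => f y ^+ 2) + c^-1 * wsum sigma (fun y => Th y ^+ 2)).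
  rewrite pairing -!wsumZ -wsumD -wsumZ.
  by apply: le_wsum => // q _; exact: mulr_le_sqrD.
have : c^-1 * wsum sigma (fun y => Th y ^+ 2) <= wsum omega (fun x => h x ^+ 2).
  by rewrite ler_pdivrMl//; exact: adjoint_le.
lra.
Qed.

Section Mixtures.
Context {R : realFieldType} {I : finType} {S T : eqType}.
Implicit Types (nu : seq (I * R)) (mu : seq (S * R)) (f : I -> S -> T) (c : R).

Definition mixture nu f mu : seq (T * R) :=
  [seq (f e.1 q.1, e.2 * q.2) | e <- nu, q <- mu].

Definition equal_weights c : seq (I * R) := [seq (e, c) | e <- enum I].

Definition uniform : seq (I * R) := equal_weights #|I|%:R^-1.

Lemma wsum_mixture nu f mu g :
  wsum (mixture nu f mu) g = wsum nu (fun e => wsum mu (g \o f e)).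
Proof.
rewrite /wsum big_allpairs_dep; apply: eq_bigr => e _.
by rewrite mulr_sumr; apply: eq_bigr => q _; rewrite mulrA.
Qed.

Lemma pos_mixture nu f mu : pos_weights nu -> pos_weights mu ->
  pos_weights (mixture nu f mu).
Proof.
by move=> nu0 mu0 _ /allpairsP[[e q] [enu qmu ->]]; rewrite mulr_gt0 ?nu0 ?mu0.
Qed.

Lemma prob_mixture nu f mu : prob_weights nu -> prob_weights mu ->
  prob_weights (mixture nu f mu).
Proof.
move=> [nu0 nu1] [mu0 mu1]; split; first exact: pos_mixture.
rewrite wsum_mixture -[RHS]nu1; apply: eq_wsum => e _.
by rewrite (_ : _ \o _ = cst 1).
Qed.

Lemma wsum_equal_weights c F : wsum (equal_weights c) F = c * \sum_e F e.
Proof. by rewrite /wsum big_map big_enum mulr_sumr. Qed.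

Lemma wsum_uniform F : wsum uniform F = #|I|%:R^-1 * \sum_e F e.
Proof. exact: wsum_equal_weights. Qed.

Lemma pos_equal_weights c : 0 < c -> pos_weights (equal_weights c).
Proof. by move=> c0 _ /mapP[e _ ->]. Qed.

Lemma prob_uniform : (0 < #|I|)%N -> prob_weights uniform.
Proof.
move=> I0; split; first by apply: pos_equal_weights; rewrite invr_gt0 ltr0n.
by rewrite wsum_uniform sumr_const mulVf// pnatr_eq0 -lt0n.
Qed.

Lemma mem_mixture c f mu e q : q \in mu ->
  (f e q.1, c * q.2) \in mixture (equal_weights c) f mu.
Proof.
move=> qmu; apply/allpairsP; exists ((e, c), q); split=> //=.
by apply/mapP; exists e; rewrite ?mem_enum.
Qed.

Lemma wvar_mixture nu f mu g : wvar (mixture nu f mu) g =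
  wvar nu (fun e => wsum mu (g \o f e)) + wsum nu (fun e => wvar mu (g \o f e)).
Proof. by rewrite /wvar !wsum_mixture wsumB; ring. Qed.

End Mixtures.
Arguments uniform {R} I.

(** * Self-similar pairs of measures *)

Section SelfSimilarMeasures.
Context {R : realType} {V : lmodType R} {I : finType}.
Variables (tau ts : R) (corner : I -> V) (Z : seq V).
Hypothesis I_gt0 : (0 < #|I|)%N.
Implicit Types (g : V -> R) (e : I) (x y z : V) (w : seq I).

Definition child_map e x : V := corner e + tau *: x.

Definition word_map w x : V := foldr child_map x w.

Fixpoint omega_meas N : seq (V * R) :=
  if N is N'.+1 then mixture (uniform I) child_map (omega_meas N') else [:: (0, 1)].

(* The mass of the points of sigma makes the energy of each node comparable to its
   omega-mass: [ts] stands for [tau ^ s]. *)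
Fixpoint sigma_meas N : seq (V * R) :=
  if N is N'.+1 then
    [seq (z, 1) | z <- Z]
      ++ mixture (equal_weights (#|I|%:R * ts ^+ 2)) child_map (sigma_meas N')
  else [::].

Definition sigma_ratio : R := (#|I|%:R * ts) ^+ 2.

Lemma wsum_omega_measS N g : wsum (omega_meas N.+1) g =
  wsum (uniform I) (fun e => wsum (omega_meas N) (g \o child_map e)).
Proof. exact: wsum_mixture. Qed.

Lemma wsum_sigma_measS N g : wsum (sigma_meas N.+1) g = \sum_(z <- Z) g z +
  sigma_ratio * wsum (uniform I) (fun e => wsum (sigma_meas N) (g \o child_map e)).
Proof.
rewrite /= wsum_cat wsum_mixture wsum_equal_weights wsum_uniform; congr (_ + _).
  by rewrite /wsum big_map; apply: eq_bigr => z _; rewrite mul1r.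
by rewrite /sigma_ratio; field; rewrite pnatr_eq0 -lt0n.
Qed.

Lemma prob_omega_meas N : prob_weights (omega_meas N).
Proof.
elim: N => [|N IH] /=; last exact: prob_mixture (prob_uniform _) IH.
by split=> [q|]; [rewrite inE => /eqP ->|rewrite /wsum big_seq1 mulr1].
Qed.

Lemma pos_omega_meas N : pos_weights (omega_meas N).
Proof. exact: (prob_omega_meas N).1. Qed.

Lemma pos_sigma_meas N : 0 < ts -> pos_weights (sigma_meas N).
Proof.
move=> ts0; elim: N => //= N IH q; rewrite mem_cat => /orP[/mapP[z _ ->]//|].
by apply: pos_mixture => //; apply: pos_equal_weights; rewrite mulr_gt0 ?exprn_gt0 ?ltr0n.
Qed.

Lemma sigma_meas_mass_le N : 2 * sigma_ratio <= 1 ->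
  wsum (sigma_meas N) (cst 1) <= 2 * (size Z)%:R.
Proof.
move=> ratio_le; elim: N => [|N IH]; first by rewrite /wsum big_nil mulr_ge0.
rewrite wsum_sigma_measS /= big_const_seq count_predT iter_addr_0.
have -> : wsum (uniform I) (fun e => wsum (sigma_meas N) (cst 1 \o child_map e))
    = wsum (sigma_meas N) (cst 1).
  by rewrite -[RHS]mulr1 -(prob_uniform (R := R) I_gt0).2 -wsum_cst.
have := ler_wpM2l (sqr_ge0 _ : 0 <= sigma_ratio) IH.
have := ler_wpM2r (ler0n R (size Z)) ratio_le.
by lra.
Qed.

Section InvariantSet.
Variable A : set V.
Hypothesis A_child : forall e x, A x -> A (child_map e x).

Lemma omega_meas_invariant N q : A 0 -> q \in omega_meas N -> A q.1.
Proof.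
move=> A0; elim: N q => [|N IH] q /=; first by rewrite inE => /eqP ->.
by case/allpairsP => -[e x] [_ /IH xA ->]; exact: A_child.
Qed.

Lemma sigma_meas_invariant N q : (forall z, z \in Z -> A z) -> q \in sigma_meas N -> A q.1.
Proof.
move=> AZ; elim: N q => // N IH q; rewrite mem_cat => /orP[/mapP[z /AZ zA ->]//|].
by case/allpairsP => -[e x] [_ /IH xA ->]; exact: A_child.
Qed.

Lemma word_map_invariant w x : A x -> A (word_map w x).
Proof. by move=> xA; elim: w => //= e w IH; exact: A_child. Qed.

Lemma omega_meas_word_ge N w (S : set V) : A 0 -> (size w < N)%N ->
  (forall e x, A x -> S (child_map e x)) ->
  #|I|%:R ^- size w <= wsum (omega_meas N) (\1_(word_map w @` S)).
Proof.
move=> A0 + childS; elim: w N => [|e w IH] [//|N] /= wN.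
  rewrite invr1 -(prob_omega_meas N.+1).2.
  apply: le_wsum => [|_ /allpairsP[[[e c] q] [_ qN ->]] /=]; first exact: pos_omega_meas.
  rewrite indicE mem_set//=; exists (child_map e q.1) => //.
  by apply: childS; exact: omega_meas_invariant qN.
rewrite wsum_omega_measS wsum_uniform exprS invfM ler_pM2l ?invr_gt0 ?ltr0n//.
apply: le_trans (IH N wN) _; rewrite (bigD1 e)//= -[leLHS]addr0 lerD//.
  apply: le_wsum => [|q _]; first exact: pos_omega_meas.
  rewrite !indicE /= ler_nat; case: (boolP (q.1 \in _)) => // /set_mem[x Sx xq].
  by rewrite mem_set//; exists x => //=; rewrite xq.
by apply: sumr_ge0 => i _; apply: wsum_ge0 => //; exact: pos_omega_meas.
Qed.

End InvariantSet.

Lemma word_mapE w x : word_map w x = word_map w 0 + tau ^+ size w *: x.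
Proof.
elim: w => [|e w IH] /=; first by rewrite expr0 scale1r add0r.
by rewrite IH /child_map scalerDr scalerA -exprS addrA.
Qed.

Lemma word_mapB w x y : word_map w x - word_map w y = tau ^+ size w *: (x - y).
Proof. by rewrite word_mapE (word_mapE w y) opprD addrACA subrr add0r scalerBr. Qed.

Lemma sigma_meas_word N w z : (size w < N)%N -> z \in Z ->
  (word_map w z, (#|I|%:R * ts ^+ 2) ^+ size w) \in sigma_meas N.
Proof.
move=> + zZ; elim: w N => [|e w IH] [//|N] /= wN; rewrite mem_cat.
  by rewrite expr0 map_f.
by rewrite exprS (mem_mixture _ _ _ (IH N wN)) orbT.
Qed.

Fixpoint words N : seq (seq I) :=
  if N is N'.+1 then [::] :: [seq e :: w | e <- enum I, w <- words N'] else [::].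

Lemma mem_words N w : (w \in words N) = (size w < N)%N.
Proof.
elim: N w => [|N IH] [|e w] //=; rewrite in_cons /= ltnS -IH.
apply/allpairsP/idP => [[[e' w'] [_ wN [_ ->]]]//|wN].
by exists (e, w); rewrite mem_enum.
Qed.

Lemma words_uniq N : uniq (words N).
Proof.
elim: N => //= N IH; apply/andP; split; first by apply/allpairsP => -[[e w] []].
by apply: allpairs_uniq => //; [exact: enum_uniq|move=> [? ?] [? ?] _ _ /= [-> ->]].
Qed.

Lemma sum_words_mass N : \sum_(w <- words N) #|I|%:R ^- size w = N%:R :> R.
Proof.
elim: N => [|N IH] /=; first by rewrite big_nil.
rewrite big_cons big_allpairs_dep big_enum /= invr1 -nat1r; congr (1 + _).
rewrite (eq_bigr (fun=> #|I|%:R^-1 * N%:R)) => [|e _].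
  by rewrite sumr_const -mulrnAl -[_ *+ _]mulr_natl mulfV ?mul1r// pnatr_eq0 -lt0n.
by rewrite -IH mulr_sumr; apply: eq_bigr => w _; rewrite exprS invfM.
Qed.

End SelfSimilarMeasures.
Arguments omega_meas {R V I} tau corner N.
Arguments words I N : clear implicits.

(** * The adjoint of a kernel with cancellation *)

Section CancellingKernel.
Context {R : realType} {V : lmodType R} {I : finType}.
Variables (tau ts : R) (corner : I -> V) (Z : seq V).
Local Notation child_map := (child_map tau corner).
Local Notation omega_meas := (omega_meas tau corner).
Local Notation sigma_meas := (sigma_meas tau ts corner Z).
Local Notation sigma_ratio := (@sigma_ratio R I ts).
Implicit Types (g : V -> R) (e : I) (x y z : V) (delta r : R).

(* [K delta r] is the kernel truncated to distances between [delta] and [r]; seen from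
   the points [Z] of a node, the points of the node lie at distances between [near] and
   [far], and up to [err] the untruncated kernel only depends on the child. *)
Record cancelling_kernel (K : R -> R -> V -> R) (child_kernel : V -> I -> R) (A : set V)
    (C err near far : R) : Prop := CancellingKernel {
  invariant_origin : A 0;
  invariant_zeros : forall z, z \in Z -> A z;
  invariant_child : forall e x, A x -> A (child_map e x);
  kernel_scale : forall delta r v,
    K delta r (tau *: v) = ts^-1 * K (delta / tau) (r / tau) v;
  kernel_siblings_le : forall delta r e e' x y, e != e' -> A x -> A y ->
    `|K delta r (child_map e x - child_map e' y)| <= C;
  kernel_zeros_le : forall delta r e x z, z \in Z -> A x ->
    `|K delta r (child_map e x - z)| <= C;
  kernel_untruncated : forall delta r e x z, z \in Z -> A x -> delta < near -> far < r ->
    `|K delta r (child_map e x - z) - child_kernel z e| <= err;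
  kernel_truncated : forall delta r e x z, z \in Z -> A x -> far < delta \/ r < near ->
    K delta r (child_map e x - z) = 0;
  child_kernel_le : forall z e, z \in Z -> `|child_kernel z e| <= C;
  child_kernel_sum0 : forall z, z \in Z -> \sum_e child_kernel z e = 0 }.

Definition radius_in (lo hi delta : R) : R := (lo <= delta <= hi)%R%:R.

(* The number of generations whose range of distances contains the radius delta. *)
Fixpoint cut_generations (lo hi : R) N delta : R :=
  if N is N'.+1 then radius_in lo hi delta + cut_generations lo hi N' (delta / tau) else 0.

Lemma cut_generations_eq0 lo hi N delta : 0 < tau -> tau <= 1 -> 0 <= hi -> hi < delta ->
  cut_generations lo hi N delta = 0.
Proof.
move=> tau0 tau1 hi0; elim: N delta => //= N IH delta hi_delta.
rewrite IH /radius_in; last by rewrite ltr_pdivlMr// (le_lt_trans _ hi_delta)// ler_piMr.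
by rewrite (leNgt delta) hi_delta andbF addr0.
Qed.

Lemma cut_generations_le1 lo hi N delta : 0 < tau -> tau <= 1 -> 0 <= hi ->
  tau * hi < lo -> cut_generations lo hi N delta <= 1.
Proof.
move=> tau0 tau1 hi0 tau_hi; elim: N delta => //= N IH delta.
rewrite /radius_in; case: (boolP (lo <= delta <= hi)) => [/andP[lo_delta _]|_].
  by rewrite cut_generations_eq0 ?addr0// ltr_pdivlMr// mulrC (lt_le_trans tau_hi).
by rewrite add0r.
Qed.

Context {K : R -> R -> V -> R} {child_kernel : V -> I -> R} {A : set V} {C err near far : R}.
Hypothesis cancelling : cancelling_kernel K child_kernel A C err near far.
Hypotheses (I_gt0 : (0 < #|I|)%N) (ts_gt0 : 0 < ts).

Definition adjoint N delta r g y : R :=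
  wsum (omega_meas N) (fun x => K delta r (x - y) * g x).

Definition sqnorm N g : R := wsum (omega_meas N) (fun x => g x ^+ 2).

Definition cuts N delta r : R :=
  cut_generations near far N delta + cut_generations near far N r.

Let omegaP N : prob_weights (omega_meas N) := prob_omega_meas tau corner I_gt0 N.
Let uniformP : prob_weights (uniform I) := @prob_uniform R I I_gt0.
Let A_omega N q : q \in omega_meas N -> A q.1 :=
  omega_meas_invariant (invariant_child cancelling) (invariant_origin cancelling).

Lemma sqnorm_ge0 N g : 0 <= sqnorm N g.
Proof. by apply: wsum_ge0 (omegaP N).1 _ => q _; exact: sqr_ge0. Qed.

Lemma sqnormS N g :
  sqnorm N.+1 g = wsum (uniform I) (fun e => sqnorm N (g \o child_map e)).
Proof. exact: wsum_omega_measS. Qed.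

Lemma adjoint_zero_truncated N delta r g z : z \in Z -> far < delta \/ r < near ->
  adjoint N.+1 delta r g z = 0.
Proof.
move=> zZ off; rewrite /adjoint /wsum big_seq big1// => _ /allpairsP[[e q] [_ /A_omega qA ->]].
by rewrite (kernel_truncated cancelling)// mul0r mulr0.
Qed.

Lemma adjoint_zero_le N delta r g z : z \in Z ->
  adjoint N.+1 delta r g z ^+ 2 <= C ^+ 2 * sqnorm N.+1 g.
Proof.
move=> zZ; apply: sqr_wsum_mul_le => // _ /allpairsP[[e q] [_ /A_omega qA ->]].
exact: (kernel_zeros_le cancelling).
Qed.

Lemma adjoint_zero_untruncated N delta r g z : z \in Z -> delta < near -> far < r ->
  adjoint N.+1 delta r g z ^+ 2 <=
  2 * C ^+ 2 * wvar (uniform I) (fun e => wsum (omega_meas N) (g \o child_map e))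
  + 2 * err ^+ 2 * sqnorm N.+1 g.
Proof.
move=> zZ delta_near far_r; set a := fun e => wsum (omega_meas N) (g \o child_map e).
pose remainder e := wsum (omega_meas N) (fun x =>
  (K delta r (child_map e x - z) - child_kernel z e) * g (child_map e x)).
have -> : adjoint N.+1 delta r g z =
    wsum (uniform I) (fun e => child_kernel z e * a e) + wsum (uniform I) remainder.
  rewrite /adjoint wsum_omega_measS -wsumD; apply: eq_wsum => e _.
  by rewrite -wsumZ -wsumD; apply: eq_wsum => q _ /=; ring.
rewrite -!(mulrA 2) (_ : 2 = 1 + 1)//.
apply: le_trans (sqrD_le _ _ ltr01) _; rewrite invr1.
apply: lerD; rewrite ler_pM2l ?addr_gt0//.
  apply: sqr_wsum_centered_mul_le => // [|[e c] _].
    by rewrite wsum_uniform (child_kernel_sum0 cancelling)// mulr0.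
  exact: (child_kernel_le cancelling).
apply: le_trans (sqr_wsum_le _ uniformP) _; rewrite sqnormS -wsumZ.
apply: le_wsum uniformP.1 _ => -[e c] _; apply: sqr_wsum_mul_le => // q /A_omega qA.
exact: (kernel_untruncated cancelling).
Qed.

Lemma adjoint_zero_wvar_le N delta r g z : z \in Z ->
  adjoint N.+1 delta r g z ^+ 2 <=
  2 * C ^+ 2 * wvar (uniform I) (fun e => wsum (omega_meas N) (g \o child_map e))
  + (2 * err ^+ 2 + C ^+ 2 * (radius_in near far delta + radius_in near far r)) * sqnorm N.+1 g.
Proof.
move=> zZ; set v := wvar _ _; set m := sqnorm _ _; set c := radius_in _ _ _ + _.
have v0 : 0 <= 2 * C ^+ 2 * v by rewrite mulr_ge0 ?wvar_ge0// mulr_ge0 ?sqr_ge0.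
have err0 : 0 <= 2 * err ^+ 2 * m by rewrite mulr_ge0 ?sqnorm_ge0// mulr_ge0 ?sqr_ge0.
have c0 : 0 <= c by rewrite addr_ge0.
have cut0 : 0 <= C ^+ 2 * c * m by rewrite mulr_ge0 ?sqnorm_ge0// mulr_ge0 ?sqr_ge0.
rewrite (mulrDl (2 * err ^+ 2)) addrA.
have [cut|] := boolP ((near <= delta <= far) || (near <= r <= far)).
  have c1 : 1 <= c.
    by rewrite /c /radius_in; case/orP: cut => ->; rewrite ?lerDl ?lerDr.
  apply: le_trans (adjoint_zero_le _ _ _ _ zZ) _; rewrite -[leLHS]add0r.
  by rewrite lerD ?addr_ge0// ler_wpM2r ?sqnorm_ge0// ler_peMr ?sqr_ge0.
rewrite negb_or !negb_and -!ltNge => /andP[delta_out r_out].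
have [off|] := pselect (far < delta \/ r < near).
  by rewrite adjoint_zero_truncated// expr0n !addr_ge0.
move=> /not_orP[/negP/negbTE far_delta /negP/negbTE r_near].
move: delta_out r_out; rewrite far_delta r_near orbF /= => delta_near far_r.
by rewrite -[leLHS]addr0 lerD//; exact: adjoint_zero_untruncated.
Qed.

Lemma adjoint_child_le N delta r g e y c : 0 < c -> A y ->
  sigma_ratio * adjoint N.+1 delta r g (child_map e y) ^+ 2 <=
  (1 + c) * adjoint N (delta / tau) (r / tau) (g \o child_map e) y ^+ 2
  + sigma_ratio * (1 + c^-1) * (C ^+ 2 * sqnorm N.+1 g).
Proof.
move=> c0 yA; set own := adjoint N _ _ _ _.
pose siblings e' := if e' == e then 0 else
  wsum (omega_meas N) (fun x => K delta r (child_map e' x - child_map e y) * g (child_map e' x)).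
have m0 : (#|I|%:R * ts) != 0 by rewrite mulf_neq0 ?gt_eqF ?ltr0n.
have -> : adjoint N.+1 delta r g (child_map e y) =
    (#|I|%:R * ts)^-1 * own + wsum (uniform I) siblings.
  rewrite /adjoint wsum_omega_measS !wsum_uniform (bigD1 e)//= [in RHS](bigD1 e)//=.
  rewrite {1}/siblings eqxx add0r mulrDr; congr (_ + _ * _).
    rewrite invfM -mulrA; congr (_ * _); rewrite -wsumZ; apply: eq_wsum => q _ /=.
    by rewrite mulrA -(kernel_scale cancelling) scalerBr /child_map opprD addrACA subrr add0r.
  by apply: eq_bigr => i /negbTE ie; rewrite /siblings ie.
apply: le_trans (ler_wpM2l (sqr_ge0 _) (sqrD_le _ _ c0)) _; rewrite mulrDr; apply: lerD.
  by rewrite [X in _ * (_ * X)]exprMn exprVn mulrCA mulVKf ?expf_neq0.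
rewrite -mulrA ler_wpM2l ?sqr_ge0// ler_wpM2l ?addr_ge0 ?invr_ge0 ?(ltW c0)//.
apply: le_trans (sqr_wsum_le _ uniformP) _; rewrite sqnormS -wsumZ.
apply: le_wsum uniformP.1 _ => -[e' c'] _ /=; rewrite /siblings.
case: eqVneq => [_|e'e]; first by rewrite expr0n mulr_ge0 ?sqr_ge0 ?sqnorm_ge0.
by apply: sqr_wsum_mul_le => // q /A_omega qA; exact: (kernel_siblings_le cancelling).
Qed.

Definition generation_error c : R :=
  2 * err ^+ 2 + 2 * sigma_ratio * (1 + c^-1) * C ^+ 2.

Lemma generation_error_le (N : nat) : (0 < N)%N -> 0 <= err -> err <= (2 * N%:R)^-1 ->
  sigma_ratio <= (4 * N%:R * (1 + 2 * N%:R) * (C ^+ 2 + 1))^-1 ->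
  N%:R * generation_error (2 * N%:R)^-1 <= 1.
Proof.
move=> N0 err0; have NR0 : 0 < N%:R :> R by rewrite ltr0n.
have NR1 : 1 <= N%:R :> R by rewrite ler1n.
have C21 : 0 < C ^+ 2 + 1 by rewrite ltr_wpDl ?sqr_ge0.
move=> err_small; rewrite -[X in _ <= X]mul1r ler_pdivlMr; last first.
  by rewrite !mulr_gt0// addr_gt0// mulr_gt0.
move=> ratio_small; have err_le : N%:R * (2 * err ^+ 2) <= 2^-1.
  apply: (@le_trans _ _ (N%:R * (2 * (2 * N%:R)^-1 ^+ 2))).
    by rewrite !ler_pM2l// lerXn2r ?nnegrE ?invr_ge0 ?mulr_ge0.
  have -> : N%:R * (2 * (2 * N%:R)^-1 ^+ 2) = 2^-1 * N%:R^-1 :> R by field; rewrite gt_eqF.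
  by rewrite ler_piMr// invf_le1.
have crossing_le : N%:R * (2 * sigma_ratio * (1 + 2 * N%:R) * C ^+ 2) <= 2^-1.
  have : 0 <= sigma_ratio * (N%:R * (1 + 2 * N%:R)).
    by rewrite mulr_ge0 ?sqr_ge0// mulr_ge0 ?addr_ge0 ?mulr_ge0 ?ltW.
  by lra.
by rewrite /generation_error invrK mulrDr; lra.
Qed.

Definition adjoint_majorant c N delta r g : R := 2 * C ^+ 2 * wvar (omega_meas N) g
  + (C ^+ 2 * cuts N delta r + N%:R * generation_error c) * sqnorm N g.

Lemma sum_adjoint_zeros_le N delta r g :
  \sum_(z <- Z) adjoint N.+1 delta r g z ^+ 2 <= (size Z)%:R *
  (2 * C ^+ 2 * wvar (uniform I) (fun e => wsum (omega_meas N) (g \o child_map e))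
   + (2 * err ^+ 2 + C ^+ 2 * (radius_in near far delta + radius_in near far r)) * sqnorm N.+1 g).
Proof.
rewrite mulr_natl -iter_addr_0 -count_predT -big_const_seq !big_seq.
by apply: ler_sum => z zZ; exact: adjoint_zero_wvar_le.
Qed.

Lemma sum_adjoint_children_le N delta r g c : 0 < c -> 2 * sigma_ratio <= 1 ->
  sigma_ratio * wsum (uniform I) (fun e => wsum (sigma_meas N)
    (fun y => adjoint N.+1 delta r g (child_map e y) ^+ 2)) <=
  (1 + c) * wsum (uniform I) (fun e => wsum (sigma_meas N)
    (fun y => adjoint N (delta / tau) (r / tau) (g \o child_map e) y ^+ 2))
  + (size Z)%:R * (2 * sigma_ratio * (1 + c^-1) * C ^+ 2) * sqnorm N.+1 g.
Proof.
move=> c0 ratio_le; set m := sqnorm N.+1 g.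
pose crossing := sigma_ratio * (1 + c^-1) * (C ^+ 2 * m).
have crossing_ge0 : 0 <= crossing.
  apply: mulr_ge0 (mulr_ge0 (sqr_ge0 _) _) (mulr_ge0 (sqr_ge0 _) (sqnorm_ge0 _ _)).
  by rewrite addr_ge0// invr_ge0 ltW.
have -> : (size Z)%:R * (2 * sigma_ratio * (1 + c^-1) * C ^+ 2) * m =
    wsum (uniform I) (cst (crossing * (2 * (size Z)%:R))).
  by rewrite wsum_cst uniformP.2 /crossing; ring.
rewrite -!wsumZ -wsumD; apply: le_wsum uniformP.1 _ => -[e u] _ /=.
apply: le_trans (lerD (lexx _) (ler_wpM2l crossing_ge0
  (@sigma_meas_mass_le _ _ _ tau ts corner Z I_gt0 N ratio_le))).
rewrite -!wsumZ -wsumD; apply: le_wsum => [|q qN]; first exact: pos_sigma_meas.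
rewrite /= mulr1; apply: adjoint_child_le => //.
exact: (sigma_meas_invariant (invariant_child cancelling) (invariant_zeros cancelling) qN).
Qed.

Lemma adjoint_le N delta r g c : 0 < c -> 2 * sigma_ratio <= 1 ->
  wsum (sigma_meas N) (fun y => adjoint N delta r g y ^+ 2) <=
  (size Z)%:R * (1 + c) ^+ N * adjoint_majorant c N delta r g.
Proof.
move=> c0 ratio_le; elim: N delta r g => [|N IH] delta r g.
  rewrite {1}/wsum big_nil expr0 mulr1 mulr_ge0// /adjoint_majorant /cuts /=.
  rewrite addr0 mulr0 mul0r addr0 mul0r addr0 mulr_ge0 ?(wvar_ge0 _ (omegaP 0))//.
  by rewrite mulr_ge0 ?sqr_ge0.
rewrite wsum_sigma_measS//; set zeros := \sum_(z <- Z) _; set children := _ * wsum _ _.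
set P := (1 + c) ^+ N.+1; set p := (size Z)%:R.
have P1 : 1 <= P by rewrite exprn_ege1// lerDl ltW.
pose v := wvar (uniform I) (fun e => wsum (omega_meas N) (g \o child_map e)).
pose top := 2 * C ^+ 2 * v + (C ^+ 2 * (radius_in near far delta + radius_in near far r)
  + generation_error c) * sqnorm N.+1 g.
have top_ge0 : 0 <= top.
  rewrite /top /generation_error; have ? : 0 <= c^-1 by rewrite invr_ge0 ltW.
  by do ?[exact: sqr_ge0 | exact: (wvar_ge0 _ uniformP) | exact: sqnorm_ge0 | exact: ler0n
    | assumption | apply: addr_ge0 | apply: mulr_ge0].
pose lower := wsum (uniform I) (fun e =>
  adjoint_majorant c N (delta / tau) (r / tau) (g \o child_map e)).
have le_top_lower : zeros + children <= p * top + p * P * lower.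
  have := sum_adjoint_zeros_le N delta r g; rewrite -/zeros -/v -/p => zeros_le.
  have := sum_adjoint_children_le N delta r g c0 ratio_le; rewrite -/children -/p.
  set deeper := wsum _ _ => children_le.
  have deeper_le : (1 + c) * deeper <= p * P * lower.
    rewrite /P exprS mulrCA -[leRHS]mulrA ler_pM2l ?addr_gt0// /lower -wsumZ.
    by apply: le_wsum uniformP.1 _ => q _; exact: IH.
  rewrite /top /generation_error; lra.
have -> : adjoint_majorant c N.+1 delta r g = top + lower.
  rewrite /lower [X in _ = _ + X]wsumD !wsumZ -sqnormS /top /adjoint_majorant wvar_mixture -/v.
  by rewrite /cuts -addn1 natrD addn1 /=; ring.
rewrite mulrDr; apply: le_trans le_top_lower _; rewrite lerD// -mulrA.
by rewrite ler_wpM2l// ler_peMl.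
Qed.

(* Choosing [c = 1 / (2 N)] keeps [(1 + c) ^ N] bounded. *)
Lemma adjoint_le_sqnorm N delta r g : (0 < N)%N -> 0 < tau -> tau <= 1 -> 0 <= far ->
  tau * far < near -> 2 * sigma_ratio <= 1 ->
  N%:R * generation_error (2 * N%:R)^-1 <= 1 ->
  wsum (sigma_meas N) (fun y => adjoint N delta r g y ^+ 2) <=
  2 * (size Z)%:R * (4 * C ^+ 2 + 1) * sqnorm N g.
Proof.
move=> N0 tau0 tau1 far0 tau_far ratio_le error_le.
have c0 : 0 < (2 * N%:R)^-1 :> R by rewrite invr_gt0 mulr_gt0 ?ltr0n.
apply: le_trans (adjoint_le N delta r g c0 ratio_le) _; set c := _^-1 in c0 error_le *.
have power_le : (1 + c) ^+ N <= 2.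
  have half : expR (2^-1 : R) <= 2.
    rewrite -[leRHS]invrK -[expR _]invrK lef_pV2 ?posrE ?invr_gt0 ?expR_gt0// -expRN.
    by apply: le_trans (expR_ge1Dx _); lra.
  apply: le_trans half; have -> : 2^-1 = N%:R * c.
    by rewrite /c; field; rewrite pnatr_eq0 -lt0n.
  by rewrite expRM_natl lerXn2r ?nnegrE ?addr_ge0 ?expR_ge0 ?expR_ge1Dx// ltW.
have majorant_le : adjoint_majorant c N delta r g <= (4 * C ^+ 2 + 1) * sqnorm N g.
  have cuts_le : cuts N delta r <= 2.
    by rewrite (_ : 2 = 1 + 1)// lerD// cut_generations_le1.
  have C2 := sqr_ge0 C; have m0 := sqnorm_ge0 N g.
  have := mulr_ge0 C2 (sqr_ge0 (wsum (omega_meas N) g)).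
  have := ler_wpM2l (mulr_ge0 C2 m0) cuts_le; have := ler_wpM2r m0 error_le.
  rewrite /adjoint_majorant /wvar -/(sqnorm N g); lra.
rewrite (mulrC 2) -!(mulrA (size Z)%:R) -(mulrA 2) ler_wpM2l//.
apply: le_trans (ler_wpM2l _ majorant_le) _; first by rewrite exprn_ge0 ?addr_ge0 ?ltW.
by rewrite ler_wpM2r// mulr_ge0 ?sqnorm_ge0// addr_ge0// mulr_ge0 ?sqr_ge0.
Qed.

End CancellingKernel.

(** * The truncated Riesz kernel *)

Section EuclideanNorm.
Context {R : realType} {n : nat}.
Implicit Types (v : pt R n) (i : 'I_n) (c : R).

Lemma coord_le_norm v i : `|v ord0 i| <= `|v|.
Proof.
by rewrite [leRHS]mx_normrE; exact: (le_bigmax _ (fun ij => `|v ij.1 ij.2|) (ord0, i)).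
Qed.

Lemma norm_le_coord v c : 0 <= c -> (forall i, `|v ord0 i| <= c) -> `|v| <= c.
Proof.
move=> c0 vc; rewrite [leLHS]mx_normrE; apply: bigmax_le => // -[j i] _ /=.
by rewrite ord1.
Qed.

Lemma coordB v w i : (v - w) ord0 i = v ord0 i - w ord0 i.
Proof. by rewrite mxE [X in _ + X]mxE. Qed.

Lemma coordD v w i : (v + w) ord0 i = v ord0 i + w ord0 i.
Proof. exact: mxE. Qed.

Lemma coord_diagonal c i : (c *: const_mx 1 : pt R n) ord0 i = c.
Proof. by rewrite !mxE mulr1. Qed.

Lemma enorm_ge0 v : 0 <= enorm v. Proof. exact: sqrtr_ge0. Qed.

Lemma enorm0 : enorm (0 : pt R n) = 0.
Proof. by rewrite /enorm big1 ?sqrtr0// => i _; rewrite mxE expr0n. Qed.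

Lemma sqr_enorm v : enorm v ^+ 2 = \sum_(i < n) v ord0 i ^+ 2.
Proof. by rewrite sqr_sqrtr// sumr_ge0// => i _; exact: sqr_ge0. Qed.

Lemma enormZ c v : 0 <= c -> enorm (c *: v) = c * enorm v.
Proof.
move=> c0; rewrite /enorm (eq_bigr (fun i => c ^+ 2 * v ord0 i ^+ 2)) => [|i _].
  by rewrite -mulr_sumr sqrtrM ?sqr_ge0// sqrtr_sqr ger0_norm.
by rewrite mxE exprMn.
Qed.

Lemma coord_le_enorm v i : `|v ord0 i| <= enorm v.
Proof.
rewrite -sqrtr_sqr ler_wsqrtr// (bigD1 i)//= lerDl.
by apply: sumr_ge0 => k _; exact: sqr_ge0.
Qed.

Lemma norm_le_enorm v : `|v| <= enorm v.
Proof. by apply: norm_le_coord (enorm_ge0 v) _ => i; exact: coord_le_enorm. Qed.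

Lemma enorm_le_norm v : enorm v <= n%:R * `|v|.
Proof.
have [n0|n0] := posnP n.
  by rewrite /enorm big1 ?sqrtr0 ?n0 ?mul0r// => i; exfalso; move: i; rewrite n0 => -[].
rewrite -(ler_pXn2r (_ : 0 < 2)%N) ?nnegrE ?enorm_ge0 ?mulr_ge0//.
apply: (@le_trans _ _ (\sum_(i < n) `|v| ^+ 2)).
  by rewrite sqr_enorm; apply: ler_sum => i _; exact: sqr_le_norm (coord_le_norm v i).
rewrite sumr_const card_ord -[leLHS]mulr_natl exprMn ler_wpM2r ?sqr_ge0//.
by rewrite expr2 ler_peMl// ler1n.
Qed.

Lemma enorm_continuous : continuous (@enorm R n).
Proof.
move=> v; apply: (@continuous_comp _ _ _ (fun v : pt R n => \sum_(i < n) v ord0 i ^+ 2)).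
  apply: continuous_big => [|i _ w]; first exact: add_continuous.
  apply: (@continuous_comp _ _ _ (fun v : pt R n => v ord0 i) (fun x => x ^+ 2)).
    exact: coord_continuous.
  exact: exprn_continuous.
exact: sqrt_continuous.
Qed.

End EuclideanNorm.

Section RieszKernel.
Context {R : realType} {n : nat}.
Variable s : R.
Hypothesis s_gt0 : 0 < s.
Implicit Types (v : pt R n) (j : 'I_n).

Definition riesz_kernel j v : R := v ord0 j / powR (enorm v) (s + 1).

Definition trunc_kernel j (delta r : R) v : R := Defs.eta delta r (enorm v) * riesz_kernel j v.

Lemma powR_addr1 (x : R) : 0 <= x -> powR x (s + 1) = x * powR x s.
Proof. by move=> x0; rewrite -(mulr_powRB1 x0) ?addrK// addr_gt0. Qed.

Lemma trunc_kernel_scale j (tau delta r : R) v : 0 < tau ->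
  trunc_kernel j delta r (tau *: v) = (powR tau s)^-1 * trunc_kernel j (delta / tau) (r / tau) v.
Proof.
move=> tau0; have tau_ge0 := ltW tau0.
rewrite /trunc_kernel /riesz_kernel enormZ// /Defs.eta ler_pdivrMr// ler_pdivlMr//.
rewrite (mulrC tau) mxE powRM ?enorm_ge0// (powR_addr1 tau_ge0).
rewrite [RHS]mulrCA; congr (_ * _); rewrite !invfM.
by rewrite [tau * _]mulrC -mulrA [in LHS](mulrCA _ tau^-1) mulVKf ?gt_eqF// mulrA mulrC.
Qed.

Lemma riesz_kernel_le j v (rho : R) : 0 < rho -> rho <= enorm v ->
  `|riesz_kernel j v| <= (powR rho s)^-1.
Proof.
move=> rho0 rho_v; have v0 := lt_le_trans rho0 rho_v.
rewrite /riesz_kernel normrM normfV (ger0_norm (powR_ge0 _ _)) powR_addr1 ?enorm_ge0//.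
rewrite invfM mulrA -[leRHS]mul1r ler_pM ?mulr_ge0 ?invr_ge0 ?powR_ge0 ?enorm_ge0//.
  by rewrite ler_pdivrMr// mul1r coord_le_enorm.
rewrite lef_pV2 ?posrE ?powR_gt0// ge0_ler_powR ?nnegrE//; exact: ltW.
Qed.

Lemma trunc_kernel_le j delta r v (rho : R) : 0 < rho -> rho <= enorm v ->
  `|trunc_kernel j delta r v| <= (powR rho s)^-1.
Proof.
move=> rho0 rho_v; apply: le_trans (riesz_kernel_le j rho0 rho_v).
by rewrite /trunc_kernel /Defs.eta; case: ifP => _; rewrite ?mul1r// mul0r normr0.
Qed.

Lemma riesz_kernel_continuous j v : 0 < enorm v -> {for v, continuous (riesz_kernel j)}.
Proof.
move=> v0; apply: continuousM; first exact: coord_continuous.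
apply: continuousV; first by rewrite gt_eqF// powR_gt0.
apply: (@continuous_comp _ _ _ (@enorm R n) (fun x => powR x (s + 1))).
  exact: enorm_continuous.
apply: differentiable_continuous; apply/derivable1_diffP; apply: derivable_powR.
by rewrite in_itv/= v0.
Qed.

Lemma riesz_kernel_near j v (err : R) : 0 < enorm v -> 0 < err ->
  \forall rho \near (0 : R)^'+, forall w, `|w - v| <= rho ->
    `|riesz_kernel j w - riesz_kernel j v| <= err.
Proof.
move=> v0 err0.
have /cvgrPdist_le/(_ _ err0)/nbhs_normP[d /= d0 dP] := @riesz_kernel_continuous j v v0.
near=> rho => w w_rho; rewrite distrC; apply: dP => /=; rewrite distrC.
by apply: le_lt_trans w_rho _; near: rho; exact: nbhs_right_lt.
Unshelve. all: by end_near. Qed.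

End RieszKernel.

Section RieszTransform.
Context {R : realType} {n : nat}.
Implicit Types (sigma omega mu : dmeas R n) (f : pt R n -> R).

Lemma dint_setT mu f : dint mu setT f = wsum mu f.
Proof. by apply: eq_bigr => q _; rewrite asboolT// mulrC. Qed.

Lemma riesz_truncE alpha sigma delta r f x j : riesz_trunc alpha sigma delta r f x ord0 j =
  wsum sigma (fun y => trunc_kernel (n%:R - alpha) j delta r (x - y) * f y).
Proof.
rewrite /riesz_trunc /wsum summxE; apply: eq_bigr => q _.
rewrite mxE /trunc_kernel /riesz_kernel (_ : n%:R - alpha + 1 = n%:R + 1 - alpha); last by ring.
ring.
Qed.

Lemma L2norm_riesz_trunc_le alpha sigma omega delta r (C : R) : 0 < C -> pos_dmeas sigma ->
  (forall j g, wsum sigma (fun y => wsum omega (fun x =>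
      trunc_kernel (n%:R - alpha) j delta r (x - y) * g x) ^+ 2)
    <= C * wsum omega (fun x => g x ^+ 2)) ->
  forall f, L2norm_vec omega (riesz_trunc alpha sigma delta r f)
    <= Num.sqrt (n%:R * C) * L2norm sigma f.
Proof.
move=> C0 sigma0 adjoint_le f.
rewrite /L2norm_vec /L2norm !dint_setT -sqrtrM; last by rewrite mulr_ge0// ltW.
apply: ler_wsqrtr.
rewrite (@eq_wsum _ _ _ _ (fun x => \sum_j wsum sigma (fun y =>
    trunc_kernel (n%:R - alpha) j delta r (x - y) * f y) ^+ 2)); last first.
  by move=> q _; rewrite sqr_enorm; apply: eq_bigr => j _; rewrite riesz_truncE.
have -> : n%:R * C * wsum sigma (fun x => f x ^+ 2) =
    \sum_(j < n) C * wsum sigma (fun x => f x ^+ 2).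
  by rewrite sumr_const card_ord -mulrA mulr_natl.
rewrite wsum_sum; apply: ler_sum => j _.
exact: (wsum_kernel_adjoint_le (k := fun x y => trunc_kernel _ j delta r (x - y))).
Qed.

End RieszTransform.

(** * The balanced configuration *)

(* The component along the axis of the sum of the fields of two unit masses, up to a
   factor 2: they sit at distance [u] along the axis and [b] on either side of it. *)
Definition axial_kernel (R : realType) (s b u : R) : R :=
  u / powR (Num.sqrt (u ^+ 2 + b ^+ 2)) (s + 1).

Lemma axial_kernelN (R : realType) (s b u : R) :
  axial_kernel s b (- u) = - axial_kernel s b u.
Proof. by rewrite /axial_kernel sqrrN mulNr. Qed.

Lemma powR_sqrt (R : realType) (x p : R) : 0 <= x ->
  powR (Num.sqrt x) p = powR x (p / 2).
Proof. by move=> x0; rewrite -powR12_sqrt// -powRrM mulrC. Qed.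

Lemma powR_gt1 (R : realType) (x p : R) : 1 < x -> 0 < p -> 1 < powR x p.
Proof.
move=> x1 p0; have /(_ 1 x) := gt0_ltr_powR p0.
by rewrite powR1 !nnegrE; apply=> //; rewrite ltW// (lt_trans _ x1).
Qed.

(* Solves [x ^ 2 + b ^ 2 = lam * (y ^ 2 + b ^ 2)] for [lam = (x / y) ^ (2 / (s + 1))]. *)
Lemma exists_axial_kernel_eq (R : realType) (s x y : R) : 0 < s -> 0 < y -> y < x ->
  exists2 b : R, 0 < b & axial_kernel s b x = axial_kernel s b y.
Proof.
move=> s0 y0 yx; pose p := s + 1; pose mu := x / y; pose lam := powR mu (2 / p).
have p0 : 0 < p by rewrite addr_gt0.
have mu1 : 1 < mu by rewrite ltr_pdivlMr// mul1r.
have mu0 : 0 < mu by rewrite (lt_trans _ mu1).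
have xE : x = mu * y by rewrite divfK ?gt_eqF.
have lam1 : 1 < lam by rewrite powR_gt1 ?divr_gt0.
have lam0 : 0 < lam by rewrite (lt_trans _ lam1).
have lam_lt : lam < mu ^+ 2.
  have <- : powR lam p = mu ^+ 2 by rewrite -powRrM divfK ?gt_eqF// -powR_mulrn// ltW.
  rewrite -(mulr_powRB1 (ltW lam0) p0) ltr_pMr//.
  by rewrite powR_gt1// addrK.
pose b2 := (x ^+ 2 - lam * y ^+ 2) / (lam - 1).
have b20 : 0 < b2.
  by rewrite divr_gt0 ?subr_gt0// xE exprMn ltr_pM2r// exprn_gt0.
exists (Num.sqrt b2); first by rewrite sqrtr_gt0.
rewrite /axial_kernel sqr_sqrtr ?(ltW b20)//; set Y := y ^+ 2 + b2.
have Y0 : 0 < Y by rewrite addr_gt0// exprn_gt0.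
have -> : x ^+ 2 + b2 = lam * Y.
  have : b2 * (lam - 1) = x ^+ 2 - lam * y ^+ 2 by rewrite divfK// subr_eq0 gt_eqF.
  by rewrite /Y; lra.
have lam_half : powR lam (p / 2) = mu.
  by rewrite -powRrM (_ : 2 / p * (p / 2) = 1) ?powRr1 ?(ltW mu0)//; field; rewrite gt_eqF.
rewrite !powR_sqrt ?mulr_ge0 ?(ltW lam0) ?(ltW Y0)// powRM ?(ltW lam0) ?(ltW Y0)// lam_half.
by rewrite xE -mulf_div divff ?mul1r ?gt_eqF.
Qed.

(* Cells have side [2 ^- cell_exp]; a subcube of relative side [2 ^- deep_exp] contains the
   two zeros, at distance [2 * 2 ^- (cell_exp + deep_exp).+2] from each other. *)
Record balanced_config (R : realType) (n : nat) (s : R) := BalancedConfig {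
  axis0 : 'I_n;
  axis1 : 'I_n;
  cell_exp : nat;
  deep_exp : nat;
  height : R;
  axis_neq : axis0 != axis1;
  cell_exp_gt0 : (0 < cell_exp)%N;
  height_gt0 : 0 < height;
  balance : axial_kernel s height (1 + 2 ^- (cell_exp + deep_exp).+2)
    = axial_kernel s height (1 - 2 ^- (cell_exp + deep_exp).+2) }.

Section Configuration.
Context {R : realType} {n : nat} {s : R}.
Variable c : balanced_config n s.
Hypothesis s_gt0 : 0 < s.
Local Notation i0 := (axis0 c).
Local Notation i1 := (axis1 c).
Local Notation b := (height c).
Implicit Types (e : bool * bool) (i j : 'I_n) (v x y z : pt R n) (tau : R).

Definition cell : R := 2 ^- cell_exp c.

Definition gap : R := 2 ^- (cell_exp c + deep_exp c).+2.

Definition unit0 : pt R n := delta_mx ord0 i0.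

Definition unit1 : pt R n := delta_mx ord0 i1.

Definition zero_left : pt R n := const_mx (cell / 2).

Definition zero_right : pt R n := zero_left + (2 * gap) *: unit0.

Definition zeros : seq (pt R n) := [:: zero_left; zero_right].

Definition midpoint : pt R n := zero_left + gap *: unit0.

Definition child_center e : pt R n :=
  midpoint + ((-1) ^+ e.1 *: unit0 + ((-1) ^+ e.2 * b) *: unit1).

Lemma cell_gt0 : 0 < cell. Proof. by rewrite invr_gt0 exprn_gt0. Qed.

Lemma gap_gt0 : 0 < gap. Proof. by rewrite invr_gt0 exprn_gt0. Qed.

Lemma cell_le : cell <= 2^-1.
Proof.
rewrite lef_pV2 ?posrE ?exprn_gt0// -[leLHS]expr1.
by rewrite ler_eXn2l ?ltr1n// cell_exp_gt0.
Qed.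

Lemma gapE : 4 * gap = 2 ^- deep_exp c * cell.
Proof.
by rewrite /gap /cell !exprS exprD; field; rewrite !expf_neq0.
Qed.

Lemma gap_le : 4 * gap <= cell.
Proof. by rewrite gapE ler_piMl ?(ltW cell_gt0)// invf_le1 ?exprn_ege1 ?exprn_gt0 ?ler1n. Qed.

Lemma coord_axes (u v : R) i :
  (u *: unit0 + v *: unit1) ord0 i = u * (i == i0)%:R + v * (i == i1)%:R.
Proof. by rewrite !mxE. Qed.

Lemma enorm_axes (u v : R) : enorm (u *: unit0 + v *: unit1) = Num.sqrt (u ^+ 2 + v ^+ 2).
Proof.
have neq := axis_neq c.
rewrite /enorm (bigD1 i0)//= (bigD1 i1)/=; last by rewrite eq_sym.
rewrite big1 => [|i /andP[/negbTE i_0 /negbTE i_1]]; last first.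
  by rewrite coord_axes i_0 i_1 !mulr0 addr0 expr0n.
rewrite !coord_axes !eqxx (negbTE neq) eq_sym (negbTE neq).
by rewrite !mulr1 !mulr0 addr0 add0r addr0.
Qed.

Lemma sum_riesz_kernel_axes j (u : R) :
  \sum_(t : bool) riesz_kernel s j (u *: unit0 + ((-1) ^+ t * b) *: unit1)
  = 2 * (j == i0)%:R * axial_kernel s b u.
Proof.
rewrite (eq_bigr (fun t : bool => (u * (j == i0)%:R + (-1) ^+ t * b * (j == i1)%:R)
    / powR (Num.sqrt (u ^+ 2 + b ^+ 2)) (s + 1))) => [|t _].
  by rewrite big_bool /= expr1 expr0 /axial_kernel; ring.
by rewrite /riesz_kernel coord_axes enorm_axes exprMn sqrr_sign mul1r.
Qed.

Lemma child_center_sub z : z \in zeros -> exists2 u : R, u = gap \/ u = - gap &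
  forall e, child_center e - z = (u + (-1) ^+ e.1) *: unit0 + ((-1) ^+ e.2 * b) *: unit1.
Proof.
rewrite !inE => /orP[] /eqP ->; [exists gap|exists (- gap)]; try by [left|right];
  move=> e; apply/rowP => i; rewrite !mxE; ring.
Qed.

Definition child_kernel j z e : R := riesz_kernel s j (child_center e - z).

Lemma child_kernel_sum_eq0 j z : z \in zeros -> \sum_e child_kernel j z e = 0.
Proof.
move=> /child_center_sub[u ugap subE].
rewrite (eq_bigr (fun e => riesz_kernel s j
    ((u + (-1) ^+ e.1) *: unit0 + ((-1) ^+ e.2 * b) *: unit1))); last first.
  by move=> e _; rewrite /child_kernel subE.
rewrite -(pair_bigA _ (fun t t' : bool => riesz_kernel s j
    ((u + (-1) ^+ t) *: unit0 + ((-1) ^+ t' * b) *: unit1))) /=.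
under eq_bigr => t _ do rewrite sum_riesz_kernel_axes.
rewrite -mulr_sumr big_bool /= expr1 expr0.
suff -> : axial_kernel s b (u - 1) + axial_kernel s b (u + 1) = 0 by rewrite mulr0.
case: ugap => ->.
  by rewrite -[_ - 1]opprB axial_kernelN (addrC _ 1) (balance c) addNr.
by rewrite -opprD axial_kernelN (addrC _ 1) (balance c) (addrC _ 1) addNr.
Qed.

Definition radius : R := 3 + b.

Definition separation : R := Num.min 4^-1 b.

Definition fine_ratio tau : Prop := 0 < tau /\ tau * (1 + radius) <= separation / 2.

(* Rounding to tau * Z^n puts the cubes of all nodes in one dyadic grid. *)
Definition rounded_center tau e : pt R n :=
  \row_i (tau * (Num.floor (child_center e ord0 i / tau))%:~R).

Lemma radius_gt0 : 0 < radius.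
Proof. by rewrite addr_gt0// height_gt0. Qed.

Lemma separation_gt0 : 0 < separation.
Proof. by rewrite lt_min invr_gt0 ltr0n height_gt0. Qed.

Lemma separation_le : separation <= 4^-1. Proof. by rewrite ge_min lexx. Qed.

Lemma norm_zeros z : z \in zeros -> `|z| <= 1.
Proof.
have := gap_gt0; have := gap_le; have := cell_le => ? ? ? zz.
apply: norm_le_coord => // i; rewrite ger0_norm; move: zz; rewrite !inE => /orP[] /eqP ->;
  rewrite !mxE; try (case: (i == i0)); rewrite /=; lra.
Qed.

Lemma norm_child_center e : `|child_center e| <= 2 + b.
Proof.
have := gap_gt0; have := gap_le; have := cell_le; have := cell_gt0.
have := height_gt0 c => ? ? ? ? ?.
apply: norm_le_coord => [|i]; first by lra.
have [? [? ?]] : cell / 2 + gap <= 1 /\ (0 <= b /\ 0 <= cell / 2) by lra.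
rewrite ler_norml !mxE; have [->|i_0] := eqVneq i i0.
  by rewrite (negbTE (axis_neq c)); case: e => -[] t /=; rewrite ?expr1 ?expr0; lra.
by case: (i == i1); case: e => t [] /=; rewrite ?expr1 ?expr0; lra.
Qed.

Lemma child_center_zeros_far e z : z \in zeros -> 2 * separation <= `|child_center e - z|.
Proof.
move=> /child_center_sub[u ugap ->]; apply: le_trans (coord_le_norm _ i0).
rewrite coord_axes eqxx (negbTE (axis_neq c)) mulr1 mulr0 addr0.
have := lerB_normD ((-1) ^+ e.1 : R) u; rewrite normr_sign [_ + u]addrC.
have -> : `|u| = gap by case: ugap => ->; rewrite ?normrN gtr0_norm ?gap_gt0.
have := gap_le; have := cell_le; have := separation_le; lra.
Qed.

Lemma dist_signs (t t' : bool) : t != t' -> `|(-1) ^+ t - (-1) ^+ t'| = 2 :> R.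
Proof.
by case: t t' => -[] //= _; rewrite expr1 expr0; [rewrite ltr0_norm|rewrite gtr0_norm]; lra.
Qed.

Lemma child_center_siblings_far e e' : e != e' ->
  2 * separation <= `|child_center e - child_center e'|.
Proof.
have b0 := height_gt0 c => neq.
have [neq0|neq1] : e.1 != e'.1 \/ e.2 != e'.2.
- by apply/orP; rewrite -negb_and -xpair_eqE -!surjective_pairing.
- apply: le_trans (coord_le_norm _ i0); rewrite coordB !mxE !eqxx (negbTE (axis_neq c)) /=.
  rewrite !mulr0 !addr0 !mulr1 opprD addrACA subrr add0r dist_signs//.
  by have := separation_le; lra.
apply: le_trans (coord_le_norm _ i1).
rewrite coordB !mxE !eqxx [_ == i0]eq_sym (negbTE (axis_neq c)) /=.
rewrite !mulr0 !add0r !mulr1 opprD addrACA subrr add0r -mulrBl normrM dist_signs//.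
by rewrite ler_pM2l// gtr0_norm// ge_min lexx orbT.
Qed.

Section FineRatio.
Variable tau : R.
Hypothesis tau_fine : fine_ratio tau.
Local Notation phi := (child_map tau (rounded_center tau)).

Let tau_gt0 : 0 < tau := tau_fine.1.

Lemma fine_ratio_le1 : tau <= 1.
Proof.
have [_] := tau_fine; have := separation_le; have := height_gt0 c => b0 ?.
by rewrite /radius; have := mulr_gt0 tau_gt0 b0; lra.
Qed.

Lemma norm_rounded_center e : `|rounded_center tau e - child_center e| <= tau.
Proof.
apply: norm_le_coord (ltW tau_gt0) _ => i; rewrite coordB [X in X - _]mxE distrC.
have := floor_itv (child_center e ord0 i / tau).
rewrite ler_pdivlMr// ltr_pdivrMr// intrD mulrDl mul1r mulrC => /andP[? ?].
by rewrite ger0_norm ?subr_ge0//; lra.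
Qed.

Lemma child_map_near e x : `|x| <= radius -> `|phi e x - child_center e| <= separation / 2.
Proof.
move=> xr; apply: le_trans tau_fine.2; rewrite /child_map addrAC mulrDr mulr1.
apply: le_trans (ler_normD _ _) _; rewrite lerD ?norm_rounded_center//.
by rewrite normrZ gtr0_norm// ler_pM2l.
Qed.

Lemma child_map_radius e x : `|x| <= radius -> `|phi e x| <= radius.
Proof.
move=> /(child_map_near e) near_center; rewrite -[phi e x](subrK (child_center e)).
apply: le_trans (ler_normD _ _) _; have := norm_child_center e; have := separation_le.
by rewrite /radius; lra.
Qed.

Lemma child_map_zeros_far e x z : z \in zeros -> `|x| <= radius ->
  separation <= enorm (phi e x - z).
Proof.
move=> zz /(child_map_near e) near_center; apply: le_trans (norm_le_enorm _).
have := child_center_zeros_far e zz.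
have := ler_distD (phi e x) (child_center e) z; rewrite (distrC _ (phi e x)).
by have := separation_gt0; lra.
Qed.

Lemma child_map_zeros_near e x z : z \in zeros -> `|x| <= radius ->
  enorm (phi e x - z) <= n%:R * (2 * radius).
Proof.
move=> /norm_zeros z1 /(child_map_radius e) phi_r; apply: le_trans (enorm_le_norm _) _.
rewrite ler_wpM2l//; apply: le_trans (ler_normB _ _) _.
by have := height_gt0 c; rewrite /radius in phi_r *; lra.
Qed.

Lemma child_map_siblings_far e e' x y : e != e' -> `|x| <= radius -> `|y| <= radius ->
  separation <= enorm (phi e x - phi e' y).
Proof.
move=> neq /(child_map_near e) xe /(child_map_near e') ye; apply: le_trans (norm_le_enorm _).
have := child_center_siblings_far neq.
have := ler_distD (phi e x) (child_center e) (child_center e').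
have := ler_distD (phi e' y) (phi e x) (child_center e'); rewrite (distrC _ (phi e x)).
by lra.
Qed.

Lemma child_map_inj e e' x y : `|x| <= radius -> `|y| <= radius ->
  phi e x = phi e' y -> e = e' /\ x = y.
Proof.
move=> xr yr E; have ee' : e = e'.
  apply/eqP/negP => /negP /child_map_siblings_far /(_ xr yr).
  by rewrite E subrr enorm0 leNgt separation_gt0.
by split=> //; move: E; rewrite ee' => /addrI /(scalerI (lt0r_neq0 tau_gt0)).
Qed.

Lemma trunc_kernel_cancelling j (err : R) :
  (forall e x z, z \in zeros -> `|x| <= radius ->
     `|riesz_kernel s j (phi e x - z) - child_kernel j z e| <= err) ->
  cancelling_kernel tau (powR tau s) (rounded_center tau) zeros (trunc_kernel s j)
    (child_kernel j) [set x | `|x| <= radius] (powR separation s)^-1 err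
    separation (n%:R * (2 * radius)).
Proof.
have sep0 := separation_gt0; have b0 := height_gt0 c => err_le.
split=> [||e x|d r v|d r e e' x y ee' xr yr|d r e x z zz xr|d r e x z zz xr ds Rr
  |d r e x z zz xr off|z e zz|z zz] /=.
- by rewrite normr0 /radius; lra.
- by move=> z /norm_zeros z1; rewrite /= /radius; lra.
- exact: child_map_radius.
- exact: trunc_kernel_scale.
- by apply: trunc_kernel_le => //; exact: child_map_siblings_far.
- by apply: trunc_kernel_le => //; exact: child_map_zeros_far.
- rewrite /trunc_kernel /Defs.eta (le_trans (ltW ds) (child_map_zeros_far e zz xr)).
  by rewrite (le_trans (child_map_zeros_near e zz xr) (ltW Rr)) mul1r; exact: err_le.
- rewrite /trunc_kernel /Defs.eta; case: ifP => [/andP[dv vr]|_]; last by rewrite mul0r.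
  case: off; rewrite ltNge => /negP[].
    exact: le_trans dv (child_map_zeros_near e zz xr).
  exact: le_trans (child_map_zeros_far e zz xr) vr.
- apply: riesz_kernel_le => //; apply: le_trans (norm_le_enorm _).
  by have := child_center_zeros_far e zz; lra.
- exact: child_kernel_sum_eq0.
Qed.

End FineRatio.

Lemma near_fine_ratio : \forall tau \near (0 : R)^'+, fine_ratio tau.
Proof.
have rad0 : 0 < 1 + radius by rewrite addr_gt0// radius_gt0.
near=> tau; split; first by near: tau; exact: nbhs_right_gt.
rewrite -ler_pdivlMr//; near: tau; apply: nbhs_right_le.
by rewrite !divr_gt0// separation_gt0.
Unshelve. all: by end_near. Qed.

Lemma near_child_kernel (err : R) : 0 < err -> \forall tau \near (0 : R)^'+,
  forall j e x z, z \in zeros -> `|x| <= radius ->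
  `|riesz_kernel s j (child_map tau (rounded_center tau) e x - z) - child_kernel j z e| <= err.
Proof.
move=> err0; have rad0 : 0 < 1 + radius by rewrite addr_gt0// radius_gt0.
have center0 e z : z \in zeros -> 0 < enorm (child_center e - z).
  move=> /(child_center_zeros_far e) far; apply: lt_le_trans (norm_le_enorm _).
  by apply: lt_le_trans far; rewrite mulr_gt0// separation_gt0.
have near_rho : \forall rho \near (0 : R)^'+,
    forall t : 'I_n * (bool * bool) * seq_sub zeros, forall v,
    `|v - (child_center t.1.2 - val t.2)| <= rho ->
    `|riesz_kernel s t.1.1 v - child_kernel t.1.1 (val t.2) t.1.2| <= err.
  apply: filter_forall => -[[j e] z] /=.
  by apply: riesz_kernel_near err0; apply: center0; exact: ssvalP.
have [rho [rho0 rhoP]] := filter_ex (filterI (nbhs_right_gt (0 : R)) near_rho).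
near=> tau => j e x z zz xr; apply: (rhoP (j, e, SeqSub zz)) => /=.
rewrite opprB addrA subrK.
have tau0 : 0 < tau by near: tau; exact: nbhs_right_gt.
have tau_rho : tau * (1 + radius) <= rho.
  by rewrite -ler_pdivlMr//; near: tau; apply: nbhs_right_le; rewrite divr_gt0.
apply: le_trans tau_rho; rewrite /child_map addrAC mulrDr mulr1.
apply: le_trans (ler_normD _ _) _; rewrite lerD//.
  by apply: norm_rounded_center; near: tau; exact: near_fine_ratio.
by rewrite normrZ gtr0_norm// ler_pM2l.
Unshelve. all: by end_near. Qed.

End Configuration.

Lemma near_powR_le (R : realType) (s e : R) : 0 < s -> 0 < e ->
  \forall x \near (0 : R)^'+, powR x s <= e.
Proof. by move=> s0 e0; apply: cvgr_le (powR_cvg0 s0) _ e0. Qed.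

Lemma near_sigma_ratio_le (R : realType) (I : finType) (s e : R) : (0 < #|I|)%N ->
  0 < s -> 0 < e -> \forall tau \near (0 : R)^'+, @sigma_ratio R I (powR tau s) <= e.
Proof.
move=> I0 s0 e0; have m0 : 0 < #|I|%:R :> R by rewrite ltr0n.
have me0 : 0 < Num.sqrt e / #|I|%:R by rewrite divr_gt0 ?sqrtr_gt0.
near=> tau; have tau0 : 0 < tau by near: tau; exact: nbhs_right_gt.
rewrite -(sqr_sqrtr (ltW e0)) lerXn2r ?nnegrE ?sqrtr_ge0 ?mulr_ge0 ?powR_ge0 ?(ltW m0)//.
rewrite mulrC -ler_pdivlMr//; near: tau; exact: near_powR_le.
Unshelve. all: by end_near. Qed.

Section ConfigurationBound.
Context {R : realType} {n : nat} {alpha : R}.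
Variable c : balanced_config n (n%:R - alpha).
Hypothesis alpha_lt : alpha < n%:R.
Local Notation s := (n%:R - alpha).
Local Notation bound := (powR (separation c) s)^-1.

Definition config_omega tau N : dmeas R n := omega_meas tau (rounded_center c tau) N.

Definition config_sigma tau N : dmeas R n :=
  sigma_meas tau (powR tau s) (rounded_center c tau) (zeros c) N.

Let s_gt0 : 0 < s. Proof. by rewrite subr_gt0. Qed.

Lemma card_signs_gt0 : (0 < #|{: bool * bool}|)%N.
Proof. by rewrite card_prod card_bool. Qed.

Lemma pos_config_omega tau N : pos_dmeas (config_omega tau N).
Proof. exact: pos_omega_meas card_signs_gt0 N. Qed.

Lemma pos_config_sigma tau N : 0 < tau -> pos_dmeas (config_sigma tau N).
Proof. by move=> tau0; apply: pos_sigma_meas card_signs_gt0 _ _; exact: powR_gt0. Qed.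

Definition adjoint_const : R := 2 * (size (zeros c))%:R * (4 * bound ^+ 2 + 1).

Lemma near_config_adjoint_le N : (0 < N)%N -> \forall tau \near (0 : R)^'+,
  forall j delta r g, wsum (config_sigma tau N) (fun y => wsum (config_omega tau N)
      (fun x => trunc_kernel s j delta r (x - y) * g x) ^+ 2)
    <= adjoint_const * wsum (config_omega tau N) (fun x => g x ^+ 2).
Proof.
move=> N0; have NR0 : 0 < N%:R :> R by rewrite ltr0n.
pose err : R := (2 * N%:R)^-1; have err0 : 0 < err by rewrite invr_gt0 mulr_gt0.
have far0 : 0 < n%:R * (2 * radius c).
  rewrite mulr_gt0 ?ltr0n ?(leq_ltn_trans _ (ltn_ord (axis0 c)))//.
  by rewrite mulr_gt0// radius_gt0.
pose ratio_max : R := (4 * N%:R * (1 + 2 * N%:R) * (bound ^+ 2 + 1))^-1.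
have ratio_max0 : 0 < ratio_max.
  by rewrite invr_gt0 !mulr_gt0// ?ltr_wpDl ?sqr_ge0// addr_gt0// mulr_gt0.
near=> tau => j delta r g; have tau0 : 0 < tau by near: tau; exact: nbhs_right_gt.
have tau_fine : fine_ratio c tau by near: tau; exact: near_fine_ratio.
have cancelling := trunc_kernel_cancelling s_gt0 tau_fine (err := err) (j := j).
apply: (adjoint_le_sqnorm (cancelling _)) => //.
- by move: (j); near: tau; exact: near_child_kernel.
- exact: card_signs_gt0.
- exact: powR_gt0.
- exact: fine_ratio_le1 tau_fine.
- exact: ltW.
- rewrite -ltr_pdivlMr//; near: tau; apply: nbhs_right_lt.
  by rewrite divr_gt0// separation_gt0.
- rewrite mulrC -ler_pdivlMr// mul1r; near: tau.
  by apply: near_sigma_ratio_le; rewrite // card_signs_gt0.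
- apply: generation_error_le => //; first exact: ltW.
  by near: tau; apply: near_sigma_ratio_le; rewrite // card_signs_gt0.
Unshelve. all: by end_near. Qed.

Lemma near_config_riesz_le N : (0 < N)%N -> \forall tau \near (0 : R)^'+,
  forall f delta r,
    L2norm_vec (config_omega tau N) (riesz_trunc alpha (config_sigma tau N) delta r f)
    <= Num.sqrt (n%:R * adjoint_const) * L2norm (config_sigma tau N) f.
Proof.
move=> N0; near=> tau => f delta r; apply: L2norm_riesz_trunc_le.
- by rewrite mulr_gt0 ?mulr_gt0 ?ltr0n// ltr_wpDl// mulr_ge0// sqr_ge0.
- by apply: pos_config_sigma; near: tau; exact: nbhs_right_gt.
move=> j g; move: j delta r g; near: tau; exact: near_config_adjoint_le.
Unshelve. all: by end_near. Qed.

End ConfigurationBound.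

(** * Dyadic cubes *)

Section Cubes.
Context {R : realType} {n : nat}.
Implicit Types (Q J K M : cube R n) (x y : pt R n) (i : 'I_n).

Lemma corner_in_cube Q : 0 < Q.2 -> cube_set Q Q.1.
Proof. by move=> Q0 i; rewrite lexx ltrDl. Qed.

Lemma diagonal_in_cube Q (c : R) : 0 <= c -> c < Q.2 -> cube_set Q (Q.1 + c *: const_mx 1).
Proof. by move=> c0 cQ i; rewrite !mxE mulr1 lerDl c0 ltrD2l. Qed.

Lemma center_in_cube Q : 0 < Q.2 -> cube_set Q (Defs.center Q).
Proof. by move=> Q0; apply: diagonal_in_cube; rewrite ?divr_ge0 ?(ltW Q0)//; lra. Qed.

Lemma half_cube_subset Q : 0 < Q.2 -> cube_set (Q.1, Q.2 / 2) `<=` cube_set Q.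
Proof.
move=> Q0 x xh i; have /= /andP[-> /= x_lt] := xh i.
by apply: lt_le_trans x_lt _; lra.
Qed.

Lemma dilate_coord (g : R) Q x i : cube_set (dilate g Q) x ->
  `|x ord0 i - Defs.center Q ord0 i| <= g * Q.2 / 2.
Proof.
move=> /(_ i); rewrite /dilate /= coordB coord_diagonal.
by rewrite ler_norml => /andP[? ?]; apply/andP; split; lra.
Qed.

Lemma subset_cube_side_le M J : (0 < n)%N -> 0 < M.2 -> cube_set M `<=` cube_set J ->
  M.2 <= J.2.
Proof.
move=> n0 M0 MJ; pose i := Ordinal n0; have /andP[J1 J2] := MJ _ (corner_in_cube M0) i.
rewrite leNgt; apply/negP => JM; have J0 : 0 <= J.2 by lra.
have /andP[_] := MJ _ (diagonal_in_cube J0 JM) i.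
by rewrite !mxE mulr1 ltrD2r ltNge J1.
Qed.

Lemma subset_cube_eq M J : 0 < M.2 -> M.2 = J.2 -> cube_set M `<=` cube_set J -> J = M.
Proof.
move=> M0 MJ2 MJ; rewrite (surjective_pairing M) (surjective_pairing J) MJ2; congr (_, _).
apply/rowP => i; apply/eqP; rewrite eq_le.
have /andP[J1 J2] := MJ _ (corner_in_cube M0) i; rewrite J1 leNgt; apply/negP => JM.
pose c := J.2 - (M.1 ord0 i - J.1 ord0 i).
have [c0 cM] : 0 <= c /\ c < M.2 by rewrite /c; lra.
have /andP[_] := MJ _ (diagonal_in_cube c0 cM) i.
by rewrite !mxE mulr1 /c; lra.
Qed.

Lemma interior_cube Q y : (forall i, Q.1 ord0 i < y ord0 i < Q.1 ord0 i + Q.2) ->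
  interior (cube_set Q) y.
Proof.
move=> yQ; rewrite /interior /=.
apply: (@filter_forall (pt R n) _ (fun i (z : pt R n) =>
    is_true (Q.1 ord0 i <= z ord0 i < Q.1 ord0 i + Q.2)) (nbhs y)) => i.
have /andP[y1 y2] := yQ i.
have coord_y := @coord_continuous R 1 n ord0 i y.
apply: (coord_y [set u : R | Q.1 ord0 i <= u < Q.1 ord0 i + Q.2]).
near=> u; apply/andP; split; first by apply/ltW; near: u; exact: lt_nbhsr.
by near: u; exact: lt_nbhsl.
Unshelve. all: by end_near. Qed.

Lemma corner_bdry Q : (0 < n)%N -> 0 < Q.2 -> bdry (cube_set Q) Q.1.
Proof.
move=> n0 Q0; split; first exact/subset_closure/corner_in_cube.
rewrite /interior => /nbhs_normP[e /= e0 ballQ].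
have e2 : 0 < e / 2 by rewrite divr_gt0.
have Qout : cube_set Q (Q.1 - (e / 2) *: const_mx 1).
  apply: ballQ; rewrite /= opprB addrC subrK.
  apply: (@le_lt_trans _ _ (e / 2)); last by lra.
  by apply: norm_le_coord (ltW e2) _ => i; rewrite coord_diagonal gtr0_norm.
by have /andP[+ _] := Qout (Ordinal n0); rewrite coordB coord_diagonal; lra.
Qed.

Lemma dist_bdry_cube_ge (A : set (pt R n)) K (d : R) : (0 < n)%N -> 0 < K.2 -> A !=set0 ->
  (forall x i, A x -> K.1 ord0 i + d <= x ord0 i <= K.1 ord0 i + K.2 - d) ->
  d <= dist_set A (bdry (cube_set K)).
Proof.
move=> n0 K0 [a Aa] margin; apply: lb_le_inf.
  by exists (enorm (a - K.1)); exists a => //; exists K.1 => //; exact: corner_bdry.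
move=> _ [x Ax] [y [_ yK]] <-.
have [i yi] : exists i, ~ (K.1 ord0 i < y ord0 i < K.1 ord0 i + K.2).
  by apply/existsNP => yin; apply: yK; exact: interior_cube.
apply: le_trans (coord_le_enorm _ i); rewrite coordB ler_normr; apply/orP.
have /andP[x_ge x_le] := margin x i Ax.
have [y_le|y_gt] := leP (y ord0 i) (K.1 ord0 i); [left|right]; first by lra.
have : K.1 ord0 i + K.2 <= y ord0 i by rewrite leNgt; apply/negP => y_lt; rewrite y_gt y_lt in yi.
by lra.
Qed.

Lemma deep_emb_center r (eps : R) K (q : nat) : (0 < n)%N -> 0 < K.2 -> (r <= q)%N ->
  2^-1 * powR (2 ^- q) eps <= 2^-1 - 2 ^- q ->
  deep_emb r eps (Defs.center K, 2 ^- q * K.2) K.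
Proof.
move=> n0 K0 rq deep_q; set J := (_, _).
have q0 : 0 < 2 ^- q :> R by rewrite invr_gt0 exprn_gt0.
have q_half : 2 ^- q <= 2^-1 :> R by have := powR_ge0 (2 ^- q : R) eps; lra.
have qK : 2 ^- q * K.2 <= 2^-1 * K.2 by rewrite ler_wpM2r// ltW.
have coordJ x i : cube_set J x ->
    K.1 ord0 i + K.2 / 2 <= x ord0 i < K.1 ord0 i + K.2 / 2 + 2 ^- q * K.2.
  by move=> /(_ i); rewrite !mxE mulr1.
split; [|split].
- by move=> x Jx i; have /andP[? ?] := coordJ _ i Jx; apply/andP; split; lra.
- rewrite /side ler_wpM2r ?(ltW K0)// lef_pV2 ?posrE ?exprn_gt0//.
  by rewrite ler_eXn2l ?ltr1n.
have -> : 2^-1 * powR (side J) eps * powR (side K) (1 - eps) =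
    2^-1 * powR (2 ^- q) eps * K.2.
  have powK : powR K.2 eps * powR K.2 (1 - eps) = K.2.
    by rewrite -powRD ?subrKC ?powRr1 ?oner_eq0 ?(ltW K0).
  by rewrite -[X in _ = _ * X]powK /side powRM ?(ltW K0) ?(ltW q0)//; ring.
apply: (@le_trans _ _ ((2^-1 - 2 ^- q) * K.2)); first by rewrite ler_wpM2r// ltW.
apply: dist_bdry_cube_ge => // [|x i Jx].
  by exists J.1; apply: corner_in_cube; rewrite mulr_gt0.
by have /andP[x1 x2] := coordJ x i Jx; apply/andP; split; lra.
Qed.

End Cubes.

Section DyadicGrid.
Context {R : realType} {n : nat}.
Variable t : int -> pt R n.
Hypothesis t_ok : grid_ok t.
Implicit Types (Q J K M : cube R n) (x : pt R n) (i : 'I_n) (k : int).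

Lemma in_grid_side_gt0 Q : in_grid t Q -> 0 < Q.2.
Proof. by case=> k [m [-> _]]; exact: exprz_gt0. Qed.

Lemma grid_shift k (j : nat) i : exists z : int,
  t k ord0 i - t (k + j%:Z) ord0 i = (2 : R) ^ k * z%:~R.
Proof.
elim: j => [|j [z tz]]; first by exists 0; rewrite addr0 subrr mulr0.
have [z' tz'] := t_ok (k + j%:Z) i; exists (z + 2 ^+ j * z').
rewrite rmorphD rmorphM rmorphXn /= mulrDr mulrA exprnP -expfzDr ?pnatr_eq0//.
by rewrite -tz -tz' intS (addrC 1) (addrA k) addrA subrK.
Qed.

Lemma in_grid_subcube K (q : nat) (z : 'I_n -> int) : in_grid t K ->
  in_grid t (\row_i (K.1 ord0 i + 2 ^- q * K.2 * (z i)%:~R), 2 ^- q * K.2).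
Proof.
move=> [k [m [Kk Km]]]; have sideE : 2 ^- q * K.2 = (2 : R) ^ (k - q%:Z).
  by rewrite Kk expfzDr ?pnatr_eq0// -exprnN mulrC.
have /choice[y yP] : forall i, exists y : int,
    t (k - q%:Z) ord0 i - t k ord0 i = (2 : R) ^ (k - q%:Z) * y%:~R.
  by move=> i; have := grid_shift (k - q%:Z) q i; rewrite subrK.
exists (k - q%:Z), (fun i => 2 ^+ q * m i - y i + z i); split=> // i.
rewrite mxE Km sideE.
have -> : (2 : R) ^ k = 2 ^ (k - q%:Z) * 2 ^+ q by rewrite exprnP -expfzDr ?pnatr_eq0// subrK.
rewrite !rmorphD rmorphN rmorphM rmorphXn /=; have := yP i; lra.
Qed.

Lemma in_grid_center_subcube K (q : nat) : (0 < q)%N -> in_grid t K ->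
  in_grid t (Defs.center K, 2 ^- q * K.2).
Proof.
case: q => // q _ /(@in_grid_subcube _ q.+1 (fun=> 2 ^+ q)); congr (in_grid _ (_, _)).
apply/rowP => i; rewrite !mxE rmorphXn /= exprS.
by field; rewrite expf_neq0.
Qed.

Lemma in_grid_half_cube K : in_grid t K -> in_grid t (K.1, K.2 / 2).
Proof.
move=> /(@in_grid_subcube _ 1 (fun=> 0)); rewrite expr1.
congr (in_grid _ (_, _)); last exact: mulrC.
by apply/rowP => i; rewrite mxE mulr0z mulr0 addr0.
Qed.

Lemma grid_relative_lattice J K : in_grid t J -> in_grid t K -> J.2 <= K.2 ->
  exists2 j : nat, K.2 = 2 ^+ j * J.2 &
    forall i, exists z : int, K.1 ord0 i = J.1 ord0 i + J.2 * z%:~R.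
Proof.
move=> [k [m [Jk Jm]]] [k' [m' [Kk Km]]]; rewrite Jk Kk ler_eXz2l ?ltr1n// => kk'.
have [j k'E] : exists j : nat, k' = k + j%:Z.
  by exists `|k' - k|%N; rewrite gez0_abs ?subr_ge0// subrKC.
have twoE : (2 : R) ^ k' = 2 ^+ j * 2 ^ k by rewrite k'E expfzDr ?pnatr_eq0// mulrC.
exists j => // i; have [z tz] := grid_shift k j i; rewrite -k'E in tz.
exists (2 ^+ j * m' i - m i - z).
by rewrite Km Jm twoE !rmorphD !rmorphN rmorphM rmorphXn /=; lra.
Qed.

Lemma grid_nested J K x : in_grid t J -> in_grid t K -> J.2 <= K.2 ->
  cube_set J x -> cube_set K x -> cube_set J `<=` cube_set K.
Proof.
move=> Jg Kg JK Jx Kx; have J0 := in_grid_side_gt0 Jg.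
have [j KE lattice] := grid_relative_lattice Jg Kg JK.
move=> y Jy i; have [z Kz] := lattice i.
have /andP[x1 x2] := Jx i; have /andP[x3 x4] := Kx i; have /andP[y1 y2] := Jy i.
have z0 : z <= 0.
  rewrite -ltzD1 add0r -(ltr_int R) -(ltr_pM2l J0) mulr1 -(ltrD2l (J.1 ord0 i)) -Kz.
  exact: le_lt_trans x2.
have zj : 1 <= z + 2 ^+ j.
  rewrite -gtz0_ge1 -(ltr_int R) rmorphD rmorphXn /= -(ltr_pM2l J0) mulr0 mulrDr.
  by move: x4; rewrite Kz KE (mulrC J.2 (2 ^+ j)); lra.
move: z0 zj; rewrite -(ler_int R) -[1 <= _](ler_int R) rmorphD rmorphXn /=.
move=> /(ler_wpM2l (ltW J0)) + /(ler_wpM2l (ltW J0)).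
rewrite mulr0 mulr1 mulrDr Kz KE (mulrC J.2 (2 ^+ j)) => ? ?.
by apply/andP; split; lra.
Qed.

Lemma grid_cube_eq J K x : in_grid t J -> in_grid t K -> J.2 = K.2 ->
  cube_set J x -> cube_set K x -> J = K.
Proof.
move=> Jg Kg JK Jx Kx; apply/esym/subset_cube_eq => //; first exact: in_grid_side_gt0 Jg.
by apply: grid_nested Jx Kx; rewrite // JK.
Qed.

Lemma exists_grid_cube k x : exists Q, [/\ in_grid t Q, Q.2 = (2 : R) ^ k & cube_set Q x].
Proof.
pose z i := Num.floor ((x ord0 i - t k ord0 i) / (2 : R) ^ k).
have k0 : 0 < (2 : R) ^ k by exact: exprz_gt0.
exists (\row_i ((2 : R) ^ k * (z i)%:~R + t k ord0 i), (2 : R) ^ k); split=> //.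
  by exists k, z; split=> // i; rewrite mxE.
move=> i; rewrite mxE /=; have := floor_itv ((x ord0 i - t k ord0 i) / (2 : R) ^ k).
rewrite -/(z i) ler_pdivlMr// ltr_pdivrMr// intrD mulrDl mul1r mulrC => /andP[? ?].
by apply/andP; split; lra.
Qed.

Lemma exists_Mdeep r (eps : R) J K : (0 < n)%N -> in_grid t J -> deep_emb r eps J K ->
  exists2 M, Mdeep t r eps K M & cube_set J `<=` cube_set M.
Proof.
move=> n0 Jg Jd; have J0 := in_grid_side_gt0 Jg.
pose P (j : nat) := `[< exists M, [/\ in_grid t M, deep_emb r eps M K,
   cube_set J `<=` cube_set M & M.2 = 2 ^+ j * J.2] >].
have exP : exists j, P j.
  by exists 0%N; apply/asboolP; exists J; rewrite expr0 mul1r; split.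
have bounded j : P j -> (j <= Num.bound (2 ^- r * K.2 / J.2))%N.
  move=> /asboolP[M [_ [_ [MK _]] _ MJ]]; rewrite leqNgt; apply/negP => /ltnW.
  by move=> /upper_nthrootP; rewrite ltr_pdivrMr// -MJ ltNge => /negP.
case: (ex_maxnP exP bounded) => j /asboolP[M [Mg Md JM Mj]] jmax.
exists M => //; split=> //; split=> // J' J'g J'd MJ'.
have MJ'2 := subset_cube_side_le n0 (in_grid_side_gt0 Mg) MJ'.
have JJ'2 := subset_cube_side_le n0 J0 (subset_trans JM MJ').
have [j' J'j _] := grid_relative_lattice Jg J'g JJ'2.
suff J'M : J'.2 <= M.2.
  rewrite (subset_cube_eq (in_grid_side_gt0 Mg) _ MJ')//.
  by apply/eqP; rewrite eq_le MJ'2.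
rewrite J'j Mj ler_pM2r// ler_eXn2l ?ltr1n//; apply: jmax; apply/asboolP.
by exists J'; split=> //; exact: subset_trans MJ'.
Qed.

Lemma Mdeep_l1 r (eps : R) K M : in_grid t K -> Mdeep t r eps K M -> Mdeep_l t r eps 1 K M.
Proof.
move=> Kg MK; have K0 := in_grid_side_gt0 Kg; have half := half_cube_subset K0.
split; last by exists M; split.
exists (K.1, K.2 / 2), K; split; first by split; [exact: in_grid_half_cube|].
split=> //; split=> //; split=> //.
by rewrite /side expr1 mulrC divfK.
Qed.

Definition dyadic_partition I (Pt : set (cube R n)) : Prop :=
  (forall Q, Pt Q -> in_grid t Q /\ cube_set Q `<=` cube_set I) /\
  (forall Q Q', Pt Q -> Pt Q' -> Q <> Q' -> cube_set Q `&` cube_set Q' = set0) /\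
  cube_set I = \bigcup_(Q in Pt) cube_set Q.

Lemma exists_dyadic_partition k I (F : set (cube R n)) : in_grid t I -> (2 : R) ^ k <= I.2 ->
  (forall Q, F Q -> [/\ in_grid t Q, cube_set Q `<=` cube_set I & (2 : R) ^ k <= Q.2]) ->
  (forall Q Q', F Q -> F Q' -> Q <> Q' -> cube_set Q `&` cube_set Q' = set0) ->
  exists2 Pt, F `<=` Pt & dyadic_partition I Pt.
Proof.
move=> Ig Ik Fsub Fdisj.
pose filling := [set Q | [/\ in_grid t Q, Q.2 = (2 : R) ^ k, cube_set Q `<=` cube_set I &
  forall Q', F Q' -> cube_set Q `&` cube_set Q' = set0]].
exists (F `|` filling); first exact: subsetUl.
split=> [Q [/Fsub[]|[]]//|]; split=> [Q Q'|].
  move=> [FQ|[Qg Qk _ Qd]] [FQ'|[Q'g Q'k _ Q'd]] QQ'; [exact: Fdisj| |exact: Qd|].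
    by rewrite setIC; exact: Q'd.
  apply/eqP/negPn/negP => /set0P[x [Qx Q'x]]; apply: QQ'.
  by apply: grid_cube_eq Qx Q'x; rewrite // Qk Q'k.
apply/seteqP; split=> [x Ix|x [Q [/Fsub[_ QI _]|[_ _ QI _]] /QI//]].
have [[Q FQ Qx]|outside] := pselect (exists2 Q, F Q & cube_set Q x).
  by exists Q => //; left.
have [Q [Qg Qk Qx]] := exists_grid_cube k x; exists Q => //; right; split=> //.
  by apply: grid_nested Qx Ix; rewrite // Qk.
move=> Q' FQ'; have [Q'g _ kQ'] := Fsub _ FQ'.
apply/eqP/negPn/negP => /set0P[y [Qy Q'y]]; apply: outside; exists Q' => //.
by apply: (grid_nested Qg Q'g _ Qy Q'y) Qx; rewrite Qk.
Qed.

End DyadicGrid.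

Section ShiftedGrid.
Context {R : realType} {n : nat}.

(* The shift moves the origin into the interior of a dyadic cube. *)
Definition shifted_grid (K : nat) : int -> pt R n := fun=> const_mx (- 2 ^+ K).

Definition origin_cube (K : nat) : cube R n := (const_mx (- 2 ^+ K), 2 ^+ K.+1).

Lemma shifted_grid_ok K : grid_ok (shifted_grid K).
Proof. by move=> k i; exists 0; rewrite subrr mulr0. Qed.

Lemma in_shifted_grid K (Q : cube R n) (e : nat) : Q.2 = 2 ^- e ->
  (forall i, exists z : int, Q.1 ord0 i = Q.2 * z%:~R) -> in_grid (shifted_grid K) Q.
Proof.
move=> Qe /choice[m Qm]; exists (- e%:Z), (fun i => m i + 2 ^+ (e + K)).
rewrite -exprnN -Qe; split=> // i.
rewrite !mxE Qm rmorphD rmorphXn /= mulrDr -addrA -[LHS]addr0; congr (_ + _).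
by rewrite Qe exprD mulKf ?subrr ?expf_neq0.
Qed.

Lemma in_grid_origin_cube K : in_grid (shifted_grid K) (origin_cube K).
Proof. by exists K.+1, (fun=> 0); split=> // i; rewrite !mxE mulr0 add0r. Qed.

Lemma norm_lt_origin_cube K (x : pt R n) : `|x| < 2 ^+ K -> cube_set (origin_cube K) x.
Proof.
move=> xK i; have := le_lt_trans (coord_le_norm x i) xK.
rewrite ltr_norml /= mxE exprS => /andP[? ?]; apply/andP; split; lra.
Qed.

End ShiftedGrid.

(** * Lower bounds for the energy *)

Lemma esum_seq_ge (R : realType) (T : choiceType) (P : set T) (f : T -> \bar R) (r : seq T) :
  uniq r -> (forall x, x \in r -> P x) ->
  (\sum_(x <- r) f x <= \esum_(x in P) f x)%E.
Proof.
move=> ur rP; apply: esum_ge; exists [set` r]; last by rewrite -fsbig_seq.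
by split; [exact: finite_seq|move=> x /= /rP].
Qed.

Section EnergyLowerBounds.
Context {R : realType} {n : nat}.
Implicit Types (mu sigma omega : dmeas R n) (A B : set (pt R n)) (f : pt R n -> R) (M : cube R n).

Lemma dmassE mu A : dmass mu A = wsum mu \1_A.
Proof.
apply: eq_bigr => q _; rewrite indicE.
by case: asboolP => [qA|qA]; [rewrite mem_set// mulr1|rewrite memNset// mulr0].
Qed.

Lemma dmass_ge0 mu A : pos_dmeas mu -> 0 <= dmass mu A.
Proof. by move=> mu0; rewrite dmassE; apply: wsum_ge0. Qed.

Lemma dint_ge_dmass mu A B f (c : R) : pos_dmeas mu -> B `<=` A ->
  (forall x, A x -> 0 <= f x) -> (forall x, B x -> c <= f x) ->
  c * dmass mu B <= dint mu A f.
Proof.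
move=> mu0 BA f0 fc; rewrite /dmass mulr_sumr /dint !big_seq; apply: ler_sum => q /mu0 q0.
case: asboolP => [qB|_]; first by rewrite asboolT ?ler_pM2r ?fc//; exact: BA.
by rewrite mulr0; case: asboolP => // qA; rewrite mulr_ge0 ?f0// ltW.
Qed.

Lemma poisson_ge alpha mu A B M (D : R) : pos_dmeas mu -> B `<=` A -> 0 < side M ->
  0 <= n%:R + 1 - alpha -> (forall x, B x -> side M + enorm (x - Defs.center M) <= D) ->
  dmass mu B / powR D (n%:R + 1 - alpha) <= poisson alpha M mu A / side M.
Proof.
move=> mu0 BA M0 p0 BD; rewrite ler_pdivlMr// -mulrA mulrC (mulrC _ (side M)).
apply: dint_ge_dmass => // x; first by rewrite divr_ge0 ?powR_ge0// ltW.
move=> /BD xD; have Mx : 0 < side M + enorm (x - Defs.center M).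
  by rewrite ltr_pwDl// enorm_ge0.
rewrite ler_pM2l// lef_pV2 ?posrE ?powR_gt0 ?(lt_le_trans Mx)//.
by rewrite ge0_ler_powR ?nnegrE ?(ltW Mx)// (le_trans (ltW Mx)).
Qed.

Lemma weighted_sqrD_ge (v w x y : R) : 0 < v -> 0 < w ->
  v * w / (v + w) * (x - y) ^+ 2 <= v * x ^+ 2 + w * y ^+ 2.
Proof.
move=> v0 w0; have vw0 : 0 < v + w by rewrite addr_gt0.
rewrite -subr_ge0 (_ : _ - _ = (v * x + w * y) ^+ 2 / (v + w)).
  by rewrite divr_ge0 ?sqr_ge0 ?ltW.
by field; rewrite gt_eqF.
Qed.

Lemma proj_x_sq_ge mu M p q : pos_dmeas mu -> p \in mu -> q \in mu -> p.1 != q.1 ->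
  cube_set M p.1 -> cube_set M q.1 ->
  p.2 * q.2 / (p.2 + q.2) * enorm (p.1 - q.1) ^+ 2 <= proj_x_sq mu M.
Proof.
move=> mu0 pmu qmu pq Mp Mq; rewrite /proj_x_sq; set avg := _ *: _.
have qmu' : q \in rem p mu.
  move: qmu; rewrite (perm_mem (perm_to_rem pmu)) inE => /orP[/eqP qp|//].
  by rewrite qp eqxx in pq.
rewrite /dint (big_rem _ pmu) (big_rem _ qmu') /= !asboolT//.
set rest := \sum_(_ <- _) _; have rest_ge0 : 0 <= rest.
  rewrite /rest big_seq; apply: sumr_ge0 => x /mem_rem /mem_rem /mu0 x0.
  by case: ifP => // _; rewrite mulr_ge0 ?sqr_ge0// ltW.
rewrite addrA -[leLHS]addr0; apply: lerD => //; rewrite !sqr_enorm mulr_sumr.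
rewrite [X in _ <= X + _]mulrC [X in _ <= _ + X]mulrC !mulr_sumr -big_split /=.
apply: ler_sum => i _.
apply: le_trans (weighted_sqrD_ge _ _ (mu0 _ pmu) (mu0 _ qmu)).
by rewrite !coordB opprB addrA subrK.
Qed.

Definition energy_term alpha gam sigma omega (I M : cube R n) : R :=
  (poisson alpha M omega (cube_set I `\` cube_set (dilate gam M)) / side M) ^+ 2
    * proj_x_sq sigma M.

Lemma bw_deep_energy_sq_ge alpha r (eps gam : R) sigma omega (t : int -> pt R n) l I Pt
    (T : eqType) (ws : seq T) (Q : T -> cube R n) (v : T -> R) :
  pos_dmeas sigma -> pos_dmeas omega -> (1 <= l)%N -> grid_ok t -> in_grid t I ->
  dyadic_partition t I Pt -> uniq ws -> {in ws &, injective Q} ->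
  (forall w, w \in ws -> Pt (Q w)) ->
  (forall w, w \in ws -> exists2 M, Mdeep_l t r eps l (Q w) M &
     v w <= energy_term alpha gam sigma omega I M) ->
  (((dmass omega (cube_set I))^-1 * \sum_(w <- ws) v w)%:E
    <= bw_deep_energy_sq alpha r eps gam sigma omega)%E.
Proof.
move=> sigma0 omega0 l1 t_ok Ig [PtI [Ptd Ptc]] ws_uniq Q_inj QPt vQ.
set term := energy_term alpha gam sigma omega I.
pose total := (\esum_(Ir in Pt) \esum_(M in Mdeep_l t r eps l Ir) (term M)%:E)%E.
apply: (@le_trans _ _ ((dmass omega (cube_set I))^-1%:E * total)%E); last first.
  by apply: ereal_sup_ubound; exists l, t, I, Pt.
rewrite EFinM lee_wpmul2l ?lee_fin ?invr_ge0 ?dmass_ge0//.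
have Qws_uniq : uniq [seq Q w | w <- ws] by rewrite map_inj_in_uniq.
apply: le_trans (esum_seq_ge _ Qws_uniq _); last by move=> _ /mapP[w ww ->]; exact: QPt.
rewrite big_map -sumEFin !big_seq; apply: lee_sum => w /vQ[M MM vM].
apply: esum_ge; exists [set M]; first by split=> [|_ ->//]; exact: finite_set1.
by rewrite fsbig_set1 lee_fin.
Qed.

End EnergyLowerBounds.

(** * Energy of the nodes *)

Section ConfigurationEnergy.
Context {R : realType} {n : nat} {alpha : R}.
Variable c : balanced_config n (n%:R - alpha).
Hypothesis alpha_lt : alpha < n%:R.
Variables (m : nat) (gam eps : R) (r : nat) (top_exp : nat).
Let tau : R := 2 ^- m.
Hypothesis tau_fine : fine_ratio c tau.
Hypotheses (gam_gt0 : 0 < gam) (cell_gam : cell c * (2 + gam) <= 2^-1).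
Hypothesis deep_exp_ge : (r <= deep_exp c)%N.
Hypothesis deep_exp_eps :
  2^-1 * powR (2 ^- deep_exp c) eps <= 2^-1 - 2 ^- deep_exp c :> R.
Hypothesis radius_lt : radius c < 2 ^+ top_exp.

Local Notation s := (n%:R - alpha).
Local Notation i0 := (axis0 c).
Local Notation mass := (#|{: bool * bool}|%:R : R).
Local Notation grid := (shifted_grid top_exp).
Local Notation top := (@origin_cube R n top_exp).
Local Notation phi := (child_map tau (rounded_center c tau)).
Local Notation word := (word_map tau (rounded_center c tau)).
Local Notation omega N := (config_omega c tau N).
Local Notation sigma N := (config_sigma c tau N).
Implicit Types (w : seq (bool * bool)) (x y z : pt R n) (M : cube R n) (e : bool * bool).

Let tau_gt0 : 0 < tau := tau_fine.1.
Let s_gt0 : 0 < s. Proof. by rewrite subr_gt0. Qed.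
Let n_gt0 : (0 < n)%N. Proof. exact: leq_ltn_trans (leq0n _) (ltn_ord i0). Qed.
Let scale_gt0 w : 0 < tau ^+ size w. Proof. exact: exprn_gt0. Qed.

Definition root_cell : cube R n := (0, cell c).

Definition node_cell w : cube R n := (word w 0, tau ^+ size w * cell c).

Definition outer_part : set (pt R n) :=
  [set y : pt R n | `|y| <= radius c /\ 2^-1 < `|y ord0 i0 - midpoint c ord0 i0|].

Lemma coord_word_map w x i : word w x ord0 i = word w 0 ord0 i + tau ^+ size w * x ord0 i.
Proof. by rewrite word_mapE mxE [X in _ + X]mxE. Qed.

Lemma node_cellP w x :
  cube_set (node_cell w) x <-> exists2 y, cube_set root_cell y & x = word w y.
Proof.
have mem_node y : cube_set (node_cell w) (word w y) <-> cube_set root_cell y.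
  have coordE i : (word w 0 ord0 i <= word w y ord0 i < word w 0 ord0 i + tau ^+ size w * cell c)
      = ((0 : pt R n) ord0 i <= y ord0 i < (0 : pt R n) ord0 i + cell c).
    by rewrite (coord_word_map w y) mxE add0r lerDl ltrD2l pmulr_rge0// ltr_pM2l.
  by split=> yQ i; have := yQ i; rewrite /= coordE.
split=> [xw|[y yQ ->]]; last exact/mem_node.
have xE : x = word w (tau ^- size w *: (x - word w 0)).
  by rewrite word_mapE scalerA mulfV ?gt_eqF// scale1r addrC subrK.
by exists (tau ^- size w *: (x - word w 0)) => //; apply/mem_node; rewrite -xE.
Qed.

Lemma root_cell_coord y i : cube_set root_cell y -> 0 <= y ord0 i < cell c.
Proof. by move=> /(_ i); rewrite /= mxE add0r. Qed.

Lemma root_cell_radius y : cube_set root_cell y -> `|y| <= radius c.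
Proof.
have := height_gt0 c; have := cell_le c => c2 b0 yQ.
apply: norm_le_coord => [|i]; rewrite /radius; first by lra.
by have /andP[y0 yc] := root_cell_coord i yQ; rewrite ger0_norm//; lra.
Qed.

Lemma midpoint_axis : midpoint c ord0 i0 = cell c / 2 + gap c.
Proof. by rewrite !mxE !eqxx mulr1. Qed.

Lemma root_cell_axis y : cube_set root_cell y ->
  `|y ord0 i0 - midpoint c ord0 i0| <= 3 / 4 * cell c.
Proof.
rewrite midpoint_axis => /(root_cell_coord i0) /andP[? ?].
have := gap_le c; have := gap_gt0 c => ? ?.
by rewrite ler_norml; apply/andP; split; lra.
Qed.

Lemma child_map_outer e x : `|x| <= radius c -> outer_part (phi e x).
Proof.
move=> xr; split; first exact: child_map_radius.
have := le_trans (coord_le_norm _ i0) (child_map_near tau_fine e xr).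
have centerE : child_center c e ord0 i0 = midpoint c ord0 i0 + (-1) ^+ e.1.
  by rewrite /child_center coordD coord_axes eqxx (negbTE (axis_neq c)) mulr0 addr0 mulr1.
rewrite coordB centerE; set v := phi e x ord0 i0 => near_center.
set a := midpoint c ord0 i0 in near_center *.
have : 1 <= `|v - a| + `|v - (a + (-1) ^+ e.1)|.
  have signE : (-1) ^+ e.1 = v - a - (v - (a + (-1) ^+ e.1)) by ring.
  by rewrite -[leLHS](normr_sign R e.1) {1}signE; exact: ler_normB.
by have := separation_le c; lra.
Qed.

Lemma word_map_radius w x : `|x| <= radius c -> `|word w x| <= radius c.
Proof.
exact: (word_map_invariant (A := [set x | `|x| <= _]) (child_map_radius tau_fine)).
Qed.

Lemma word_map_cell_inj w w' y y' : cube_set root_cell y -> cube_set root_cell y' ->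
  word w y = word w' y' -> w = w'.
Proof.
move=> yQ y'Q.
have not_root e v x x' : cube_set root_cell x -> cube_set root_cell x' ->
    x <> word (e :: v) x'.
  move=> /root_cell_axis + /root_cell_radius x'r xE; rewrite xE leNgt => /negP; apply.
  have [_] := child_map_outer e (word_map_radius v x'r).
  by apply: le_lt_trans; have := cell_le c; lra.
elim: w w' => [|e w IH] [|e' w'] //=.
- by move=> /(not_root _ _ _ _ yQ y'Q).
- by move=> /esym/(not_root _ _ _ _ y'Q yQ).
have cell_radius v x : cube_set root_cell x -> `|word v x| <= radius c.
  by move=> /root_cell_radius; exact: word_map_radius.
by move=> /(child_map_inj tau_fine (cell_radius _ _ yQ) (cell_radius _ _ y'Q))[-> /IH ->].
Qed.

Lemma node_cells_disjoint w w' x :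
  cube_set (node_cell w) x -> cube_set (node_cell w') x -> w = w'.
Proof.
by move=> /node_cellP[y yQ ->] /node_cellP[y' y'Q]; exact: word_map_cell_inj.
Qed.

Lemma node_cell_side_gt0 w : 0 < (node_cell w).2.
Proof. by rewrite mulr_gt0// cell_gt0. Qed.

Lemma node_cell_inj : injective node_cell.
Proof.
move=> w w' ww'; have xw := corner_in_cube (node_cell_side_gt0 w).
by apply: (node_cells_disjoint xw); rewrite -ww'.
Qed.

Lemma in_grid_node_cell w : in_grid grid (node_cell w).
Proof.
have tauE k : tau ^+ k = 2 ^- (m * k) by rewrite exprVn -exprM.
apply: (@in_shifted_grid _ _ _ _ (m * size w + cell_exp c)) => [|i].
  by rewrite /node_cell /= tauE exprD invfM.
have [z wz] : exists z : int, word w 0 ord0 i = tau ^+ size w * z%:~R.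
  elim: w => [|e w [z wz]] /=; first by exists 0; rewrite mxE mulr0.
  exists (Num.floor (child_center c e ord0 i / tau) * 2 ^+ (m * size w) + z).
  rewrite /child_map !mxE wz exprS tauE rmorphD rmorphM rmorphXn /=.
  by rewrite mulrDr mulrA; congr (_ + _); field; rewrite expf_neq0.
exists (z * 2 ^+ cell_exp c); rewrite /node_cell /= wz /cell rmorphM rmorphXn /=.
by field; rewrite expf_neq0.
Qed.

Lemma node_cell_top w : cube_set (node_cell w) `<=` cube_set top.
Proof.
move=> x /node_cellP[y /root_cell_radius yr ->]; apply: norm_lt_origin_cube.
by apply: le_lt_trans radius_lt; exact: word_map_radius.
Qed.

Lemma omega_radius N q : q \in omega N -> `|q.1| <= radius c.
Proof.
apply: (omega_meas_invariant (A := [set x | `|x| <= _]) (child_map_radius tau_fine)).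
by rewrite /= normr0 ltW// radius_gt0.
Qed.

Lemma dmass_omega_top N : dmass (omega N) (cube_set top) = 1.
Proof.
rewrite -(prob_omega_meas tau (rounded_center c tau) card_signs_gt0 N).2 dmassE.
apply: eq_wsum => q /omega_radius qr; rewrite indicE mem_set//=.
by apply: norm_lt_origin_cube; exact: le_lt_trans radius_lt.
Qed.

Lemma deep_cube_zeros w z : z \in zeros c ->
  cube_set (Defs.center (node_cell w), 2 ^- deep_exp c * (node_cell w).2) (word w z).
Proof.
move=> zz i; rewrite coord_word_map /= coordD coord_diagonal /=.
have := scale_gt0 w; set rho := tau ^+ _ => rho0.
have rho_gap := mulr_gt0 rho0 (gap_gt0 c).
rewrite mulrCA -(gapE c); have zi : z ord0 i = cell c / 2 \/ z ord0 i = cell c / 2 + 2 * gap c.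
  move: zz; rewrite !inE => /orP[] /eqP ->; rewrite !mxE ?eqxx; first by left.
  by case: (i == i0); rewrite ?mulr1 ?mulr0 ?addr0; [right|left].
by case: zi => ->; apply/andP; split; lra.
Qed.

Lemma omega_outer_ge N w : (size w < N)%N ->
  mass ^- size w <= dmass (omega N) (word w @` outer_part).
Proof.
move=> wN; rewrite dmassE.
apply: (omega_meas_word_ge card_signs_gt0 (A := [set x | `|x| <= radius c])) => //.
- exact: child_map_radius.
- by rewrite /= normr0 ltW// radius_gt0.
- exact: child_map_outer.
Qed.

Lemma outer_part_far w M x : cube_set M `<=` cube_set (node_cell w) -> 0 < M.2 ->
  (word w @` outer_part) x -> ~ cube_set (dilate gam M) x.
Proof.
move=> Mw M0 [y [yr y_far] <-] /(dilate_coord i0).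
have /node_cellP[y0 /root_cell_axis y0_near ->] := Mw _ (center_in_cube M0).
rewrite -coordB word_mapB mxE coordB normrM gtr0_norm//; apply/negP; rewrite -ltNge.
have side_le : gam * M.2 / 2 <= tau ^+ size w * (gam * cell c / 2).
  have := subset_cube_side_le n_gt0 M0 Mw; rewrite /node_cell /=.
  by move=> /(ler_wpM2l (ltW gam_gt0)); lra.
apply: le_lt_trans side_le _; rewrite ltr_pM2l//.
have := ler_distD (y0 ord0 i0) (y ord0 i0) (midpoint c ord0 i0).
by have := cell_gt0 c; have := cell_gam; lra.
Qed.

Definition node_reach : R := 1 + n%:R * (2 * radius c).

Lemma node_reach_gt0 : 0 < node_reach.
Proof.
by rewrite ltr_wpDr// mulr_ge0// mulr_ge0// ltW// radius_gt0.
Qed.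

Lemma outer_part_near w M x : cube_set M `<=` cube_set (node_cell w) -> 0 < M.2 ->
  (word w @` outer_part) x -> M.2 + enorm (x - Defs.center M) <= tau ^+ size w * node_reach.
Proof.
move=> Mw M0 [y [yr _] <-]; rewrite /node_reach mulrDr mulr1; apply: lerD.
  apply: le_trans (subset_cube_side_le n_gt0 M0 Mw) _; rewrite /node_cell /=.
  by rewrite ler_piMr ?(ltW (scale_gt0 w))//; have := cell_le c; lra.
have /node_cellP[y0 /root_cell_radius y0r ->] := Mw _ (center_in_cube M0).
rewrite word_mapB enormZ ?(ltW (scale_gt0 w))// ler_pM2l//.
apply: le_trans (enorm_le_norm _) _; rewrite ler_wpM2l//.
by apply: le_trans (ler_normB _ _) _; lra.
Qed.

Lemma node_poisson_ge N w M : (size w < N)%N -> cube_set M `<=` cube_set (node_cell w) ->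
  0 < M.2 -> mass ^- size w / powR (tau ^+ size w * node_reach) (s + 1) <=
  poisson alpha M (omega N) (cube_set top `\` cube_set (dilate gam M)) / side M.
Proof.
move=> wN Mw M0; rewrite (_ : s + 1 = n%:R + 1 - alpha); last by ring.
apply: le_trans (poisson_ge (B := word w @` outer_part)
  (D := tau ^+ size w * node_reach) _ _ M0 _ _).
- by rewrite ler_wpM2r ?invr_ge0 ?powR_ge0//; exact: omega_outer_ge.
- exact: pos_config_omega.
- move=> x wx; split; last exact: outer_part_far wx.
  case: wx => y [yr _] <-; apply: norm_lt_origin_cube.
  by apply: le_lt_trans radius_lt; exact: word_map_radius.
- by rewrite addrAC addr_ge0// ltW.
- by move=> x; exact: outer_part_near.
Qed.

Lemma node_proj_ge N w M : (size w < N)%N ->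
  (forall z, z \in zeros c -> cube_set M (word w z)) ->
  2 * gap c ^+ 2 * ((mass * powR tau s ^+ 2) ^+ size w * (tau ^+ size w) ^+ 2)
    <= proj_x_sq (sigma N) M.
Proof.
move=> wN zM; set u := (_ * powR _ _ ^+ 2) ^+ _; set rho := tau ^+ _.
have u0 : 0 < u.
  by rewrite exprn_gt0// mulr_gt0 ?ltr0n ?card_signs_gt0// exprn_gt0// powR_gt0.
have left_in : zero_left c \in zeros c by rewrite inE eqxx.
have right_in : zero_right c \in zeros c by rewrite !inE eqxx orbT.
have memz z : z \in zeros c -> (word w z, u) \in sigma N by exact: sigma_meas_word.
have dist : enorm (word w (zero_right c) - word w (zero_left c)) = rho * (2 * gap c).
  rewrite word_mapB enormZ ?(ltW (scale_gt0 w))//; congr (_ * _).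
  rewrite /zero_right addrAC subrr add0r -[_ *: _]addr0 -(scale0r (unit1 c)).
  by rewrite enorm_axes expr0n addr0 sqrtr_sqr gtr0_norm// mulr_gt0// gap_gt0.
have dist_gt0 : 0 < rho * (2 * gap c) by rewrite mulr_gt0 ?scale_gt0// mulr_gt0 ?gap_gt0.
apply: le_trans (proj_x_sq_ge _ (memz _ right_in) (memz _ left_in) _ (zM _ right_in)
  (zM _ left_in)).
- by rewrite /= dist le_eqVlt; apply/orP; left; apply/eqP; field; rewrite gt_eqF// addr_gt0.
- by apply: pos_config_sigma.
- by apply: contraTneq dist_gt0 => /= same; rewrite -dist same subrr enorm0 ltxx.
Qed.

Definition energy_const : R := 2 * gap c ^+ 2 / powR node_reach (s + 1) ^+ 2.

Lemma energy_const_gt0 : 0 < energy_const.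
Proof.
by rewrite divr_gt0 ?exprn_gt0 ?powR_gt0 ?node_reach_gt0// mulr_gt0 ?exprn_gt0 ?gap_gt0.
Qed.

Lemma energy_const_node w : energy_const * mass ^- size w =
  (mass ^- size w / powR (tau ^+ size w * node_reach) (s + 1)) ^+ 2 *
  (2 * gap c ^+ 2 * ((mass * powR tau s ^+ 2) ^+ size w * (tau ^+ size w) ^+ 2)).
Proof.
have massE : (mass * powR tau s ^+ 2) ^+ size w =
    mass ^+ size w * powR (tau ^+ size w) s ^+ 2.
  rewrite exprMn -exprM mulnC exprM; congr (_ * _ ^+ 2).
  by rewrite -!powR_mulrn ?powR_ge0 ?(ltW tau_gt0)// powRAC.
rewrite massE /energy_const powRM ?(ltW (scale_gt0 w)) ?(ltW node_reach_gt0)//.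
rewrite (powR_addr1 s_gt0 (ltW (scale_gt0 w))).
field; rewrite !gt_eqF// ?exprn_gt0 ?powR_gt0 ?node_reach_gt0//.
by rewrite ltr0n card_signs_gt0.
Qed.

Lemma node_energy_ge N w : (size w < N)%N -> exists2 M, Mdeep_l grid r eps 1 (node_cell w) M &
  energy_const * mass ^- size w <= energy_term alpha gam (sigma N) (omega N) top M.
Proof.
move=> wN; have grid_ok := @shifted_grid_ok R n top_exp.
have cell_in := in_grid_node_cell w.
have deep_exp_gt0 : (0 < deep_exp c)%N.
  rewrite lt0n; apply: contraTneq deep_exp_eps => ->; rewrite expr0 invr1 powR1; lra.
have J_in := in_grid_center_subcube grid_ok deep_exp_gt0 cell_in.
have J_deep := deep_emb_center n_gt0 (node_cell_side_gt0 w) deep_exp_ge deep_exp_eps.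
have [M M_max JM] := exists_Mdeep grid_ok n_gt0 J_in J_deep.
exists M; first exact: Mdeep_l1.
have [M_in [[Mw _] _]] := M_max; have M0 := in_grid_side_gt0 M_in.
have lower0 : 0 <= mass ^- size w / powR (tau ^+ size w * node_reach) (s + 1).
  by rewrite divr_ge0 ?powR_ge0// invr_ge0 exprn_ge0.
have poisson_le := node_poisson_ge wN Mw M0.
rewrite energy_const_node; apply: ler_pM; rewrite ?sqr_ge0//.
- apply: mulr_ge0 (mulr_ge0 (ler0n _ 2) (sqr_ge0 _)) (mulr_ge0 _ (sqr_ge0 _)).
  exact: exprn_ge0 (mulr_ge0 (ler0n _ _) (sqr_ge0 _)).
- by rewrite lerXn2r ?nnegrE// (le_trans lower0).
- by apply: node_proj_ge => // z zz; apply: JM; exact: deep_cube_zeros.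
Qed.

Lemma exists_node_partition N : exists2 Pt,
  forall w, (size w < N)%N -> Pt (node_cell w) & dyadic_partition grid top Pt.
Proof.
pose cells := [set Q | exists2 w, (size w < N)%N & Q = node_cell w].
pose k : int := - (m * N + cell_exp c)%N%:Z.
have [|_ [w wN ->]|_ _ [w _ ->] [w' _ ->] ww'|Pt cellsPt Pt_part] :=
  @exists_dyadic_partition _ _ grid (@shifted_grid_ok R n top_exp) k top cells
    (@in_grid_origin_cube R n top_exp).
- by rewrite /= exprnP ler_eXz2l ?ltr1n// (@le_trans _ _ 0)// oppr_le0.
- split; [exact: in_grid_node_cell|exact: node_cell_top|].
  rewrite /node_cell /= /tau exprVn -exprM /cell -invfM -exprD exprnN ler_eXz2l ?ltr1n//.
  by rewrite lerN2 lez_nat leq_add2r leq_mul2l ltnW ?orbT.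
- apply/eqP/negPn/negP => /set0P[x [xw xw']].
  by apply: ww'; rewrite (node_cells_disjoint xw xw').
by exists Pt => // w wN; apply: cellsPt; exists w.
Qed.

Lemma config_energy_ge N : ((energy_const * N%:R)%:E <=
  bw_deep_energy_sq alpha r eps gam (sigma N) (omega N))%E.
Proof.
have [Pt node_Pt Pt_part] := exists_node_partition N.
have -> : energy_const * N%:R = (dmass (omega N) (cube_set top))^-1 *
    \sum_(w <- words (bool * bool)%type N) energy_const * mass ^- size w.
  by rewrite dmass_omega_top invr1 mul1r -mulr_sumr sum_words_mass// card_signs_gt0.
apply: (bw_deep_energy_sq_ge (l := 1) (Q := node_cell) _ _ _ _ _ Pt_part
  (words_uniq N) (in2W node_cell_inj)) => //.
- by apply: pos_config_sigma.
- exact: pos_config_omega.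
- exact: shifted_grid_ok.
- exact: in_grid_origin_cube.
- by move=> w; rewrite mem_words; exact: node_Pt.
- by move=> w; rewrite mem_words; exact: node_energy_ge.
Qed.

End ConfigurationEnergy.

(** * Choice of the parameters *)

Lemma near_right0_pow2 (R : realType) (P : R -> Prop) :
  (\forall x \near (0 : R)^'+, P x) -> exists m : nat, P (2 ^- m).
Proof.
rewrite near_withinE => /nbhs_ballP[e /= e0 eP]; exists (Num.bound e^-1).
have pow0 m : 0 < 2 ^- m :> R by rewrite invr_gt0 exprn_gt0.
apply: eP; rewrite // /ball /= sub0r normrN gtr0_norm//.
by rewrite -[ltRHS]invrK ltf_pV2 ?posrE ?invr_gt0 ?exprn_gt0//; exact: upper_nthrootP.
Qed.

Lemma exists_balanced_config (R : realType) (n : nat) (s gam eps : R) (r : nat) :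
  (1 < n)%N -> 0 < s -> 0 < gam -> 0 < eps -> exists c : balanced_config n s,
  [/\ cell c * (2 + gam) <= 2^-1, (r <= deep_exp c)%N &
      2^-1 * powR (2 ^- deep_exp c) eps <= 2^-1 - 2 ^- deep_exp c :> R].
Proof.
move=> n1 s0 gam0 eps0; have pow0 m : 0 < 2 ^- m :> R by rewrite invr_gt0 exprn_gt0.
have [a cell_le] : exists a : nat, 2 ^- a * (2 + gam) <= 2^-1.
  apply: (@near_right0_pow2 _ (fun x => x * (2 + gam) <= 2^-1)); near=> x.
  by rewrite -ler_pdivlMr ?addr_gt0//; near: x; apply: nbhs_right_le; rewrite divr_gt0 ?addr_gt0.
have [q [q_r q_eps]] : exists q : nat, 2 ^- q <= 2 ^- r :> R /\
    2^-1 * powR (2 ^- q) eps <= 2^-1 - 2 ^- q :> R.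
  apply: (@near_right0_pow2 _ (fun z => z <= 2 ^- r /\ 2^-1 * powR z eps <= 2^-1 - z)).
  near=> z; split; first by near: z; apply: nbhs_right_le.
  have : powR z eps <= 2^-1 by near: z; apply: near_powR_le; rewrite ?invr_gt0.
  have : z <= 4^-1 by near: z; apply: nbhs_right_le; rewrite invr_gt0.
  by lra.
have a0 : (0 < a)%N.
  by rewrite lt0n; apply: contraTneq cell_le => ->; rewrite expr0 invr1 -ltNge; lra.
pose gap : R := 2 ^- (a + q).+2.
have gap_le : gap <= 2 ^- 2 by rewrite lef_pV2 ?posrE ?exprn_gt0// ler_eXn2l ?ltr1n.
have gap0 : 0 < gap by exact: pow0.
have [||b b0 balance] := @exists_axial_kernel_eq _ s (1 + gap) (1 - gap) s0; [lra..|].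
exists (@BalancedConfig _ _ _ (Ordinal (ltnW n1)) (Ordinal n1) a q b isT a0 b0 balance).
by split=> //=; rewrite lef_pV2 ?posrE ?exprn_gt0// ler_eXn2l ?ltr1n in q_r.
Unshelve. all: by end_near. Qed.

Lemma exists_config_ratio (R : realType) (n : nat) (alpha : R)
    (c : balanced_config n (n%:R - alpha)) (N : nat) : alpha < n%:R ->
  exists m : nat, (0 < N)%N -> fine_ratio c (2 ^- m) /\ forall f delta r,
    L2norm_vec (config_omega c (2 ^- m) N)
      (riesz_trunc alpha (config_sigma c (2 ^- m) N) delta r f)
    <= Num.sqrt (n%:R * adjoint_const c) * L2norm (config_sigma c (2 ^- m) N) f.
Proof.
move=> alpha_lt; case: N => [|N]; first by exists 0%N.
have [m mP] := near_right0_pow2 (filterI (near_fine_ratio c)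
  (near_config_riesz_le c alpha_lt (ltn0Sn N))).
by exists m.
Qed.

Unset Implicit Arguments.

Theorem theorem1 (R : realType) (n : nat) (alpha : R) (r : nat) (eps gam : R) :
  (2 <= n)%N -> 0 <= alpha -> alpha < n%:R ->
  0 < eps -> eps < 1 -> 1 < gam ->
  exists (sigma omega : nat -> dmeas R n),
    (forall N, (1 <= N)%N -> pos_dmeas (sigma N) /\ pos_dmeas (omega N)) /\
    (forall B : R, exists N, (1 <= N)%N /\
        (B%:E < bw_deep_energy_sq alpha r eps gam (sigma N) (omega N))%E) /\
    (exists C : R, forall N, (1 <= N)%N ->
       forall (f : pt R n -> R) (delta R0 : R), 0 < delta -> delta < R0 ->
         L2norm_vec (omega N) (riesz_trunc alpha (sigma N) delta R0 f)
           <= C * L2norm (sigma N) f).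
Proof.
move=> n2 _ alpha_lt eps0 _ gam1; have gam0 : 0 < gam := lt_trans ltr01 gam1.
have s0 : 0 < n%:R - alpha by rewrite subr_gt0.
have [c [cell_gam deep_ge deep_eps]] := exists_balanced_config r n2 s0 gam0 eps0.
have /choice[m mP] := (fun N => exists_config_ratio c N alpha_lt).
exists (fun N => config_sigma c (2 ^- m N) N), (fun N => config_omega c (2 ^- m N) N).
split=> [N /mP[[tau0 _] _]|].
  by split; [exact: pos_config_sigma|exact: pos_config_omega].
split=> [B|]; last by exists (Num.sqrt (n%:R * adjoint_const c)) => N /mP[_ bound] f delta R0 _ _.
have const0 := energy_const_gt0 c; pose N := (Num.bound (`|B| / energy_const c)).+1.
exists N; split=> //; have [tau_fine _] := mP N isT.
apply: lt_le_trans (config_energy_ge alpha_lt tau_fine gam0 cell_gam deep_ge deep_eps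
  (upper_nthrootP (leqnn (Num.bound (radius c)))) N).
rewrite lte_fin mulrC -ltr_pdivrMr//; apply: le_lt_trans (_ : `|B| / energy_const c < _).
  by rewrite ler_wpM2r ?ler_norm// invr_ge0 ltW.
apply: lt_trans (archi_boundP _) _; last by rewrite ltr_nat.
by rewrite divr_ge0// ltW.
Qed.
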